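(* Let $n>k>0$ and let $L\subset\mathbb{R}^n$ be an $(n-k)$-dimensional subspace none of whose Plücker coordinates vanishes. Then there exist real numbers $t_1,t_2,\ldots,t_{k(n-k)}\in\mathbb{R}^\times$ such that for every $\alpha\in\binom{[n]}{k}$ the intersection $$\Omega_\alpha\cap\Omega(t_1.L)\cap\Omega(t_2.L)\cap\cdots\cap\Omega(t_{|\alpha|}.L)$$ in $\mathrm{Gr}(k,n)$ is transverse, consists of exactly $d(\alpha)$ points, and all of these points are real.
   Context: $\mathrm{Gr}(k,n)$ is the Grassmannian of $k$-dimensional subspaces of $\mathbb{C}^n$, with fixed basis $e_1,\ldots,e_n$ (real structure from $\mathbb{R}^n$). $\binom{[n]}{k}$ is the set of sequences $\alpha=(1\le\alpha_1<\cdots<\alpha_k\le n)$, partially ordered by $\beta\le\alpha$ iff $\beta_j\le\alpha_j$ for all $j$ (Bruhat order), with $|\alpha|=\sum_j(\alpha_j-j)$ and minimum $\hat0=(1,\ldots,k)$. Writing a $k$-plane $K$ as the row space of a $k\times n$ matrix, its Plücker coordinate $p_\alpha(K)$ is the maximal minor in columns $\alpha$; Plücker coordinates of an $(n-k)$-plane are defined analogously by $(n-k)\times(n-k)$ minors. $\Omega_\alpha=\{K\in\mathrm{Gr}(k,n): p_\beta(K)=0 \text{ for all } \beta\not\le\alpha\}$. For an $(n-k)$-plane $M$, $\Omega(M)=\{K: K\cap M\ne\{0\}\}$. $\mathbb{R}^\times$ acts on $\mathbb{R}^n$ (and $\mathbb{C}^n$) by $t.e_j=t^je_j$, and $t.L$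 is the image of $L$. $d(\alpha)$ is the number of saturated chains $\hat0\lessdot\cdots\lessdot\alpha$ in the Bruhat order (it is the degree of $\Omega_\alpha$ in the Plücker embedding). *)

(* Defs.v *)
From HB Require Import structures.
From mathcomp Require Import all_boot all_order all_algebra.
From mathcomp Require Import complex.
From mathcomp Require Import reals.
Set Implicit Arguments. Unset Strict Implicit. Unset Printing Implicit Defensive.
Import Order.TTheory GRing.Theory Num.Theory.
Local Open Scope ring_scope.

(* Combinatorics of binom([n],k): sequences alpha_1 < ... < alpha_k,  *)
(* represented (0-indexed) as finite functions 'I_k -> 'I_n.          *)
Definition incr (k n : nat) (a : {ffun 'I_k -> 'I_n}) : bool :=
  [forall i : 'I_k, forall j : 'I_k, (i < j)%N ==> (a i < a j)%N].

Definition bruhat_le (k n : nat) (b a : {ffun 'I_k -> 'I_n}) : bool :=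
  [forall j : 'I_k, (b j <= a j)%N].

(* |alpha| = sum_j (alpha_j - j)  (the same in 0- or 1-indexing) *)
Definition weight (k n : nat) (a : {ffun 'I_k -> 'I_n}) : nat :=
  (\sum_(j < k) (a j - j))%N.

Definition is_bot (k n : nat) (a : {ffun 'I_k -> 'I_n}) : bool :=
  [forall j : 'I_k, (a j == j :> nat)].

Definition covers (k n : nat) (b c : {ffun 'I_k -> 'I_n}) : bool :=
  [&& incr b, incr c, bruhat_le b c, b != c &
   ~~ [exists e : {ffun 'I_k -> 'I_n},
        [&& incr e, bruhat_le b e, bruhat_le e c, e != b & e != c]]].

(* d(alpha): number of saturated chains 0^ <. c_1 <. ... <. c_m = alpha.
   A chain with m steps has m+1 distinct elements, hence m < #|T|. *)
Definition nchains (k n : nat) (a : {ffun 'I_k -> 'I_n}) : nat :=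
  (\sum_(m < #|{ffun 'I_k -> 'I_n}|)
     #|[set c : {ffun 'I_m.+1 -> {ffun 'I_k -> 'I_n}} |
        [&& is_bot (c ord0), c ord_max == a &
            [forall i : 'I_m, covers (c (widen_ord (leqnSn m) i)) (c (lift ord0 i))]]]|)%N.

(* Linear algebra: a k-plane K in C^n is the row space of a rank-k    *)
(* k x n matrix.  Here n = k + m.                                     *)
Section Geometry.
Variable R : realType.
Local Notation C := R[i].

Definition cR (x : R) : C := real_complex R x.

Definition plucker (k n : nat) (a : {ffun 'I_k -> 'I_n}) (A : 'M[C]_(k, n)) : C :=
  \det (colsub a A).

Definition inSchubert (k n : nat) (a : {ffun 'I_k -> 'I_n}) (A : 'M[C]_(k, n)) : Prop :=
  forall b : {ffun 'I_k -> 'I_n}, incr b -> ~~ bruhat_le b a -> plucker b A = 0.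

Definition inOmegaM (k m : nat) (B : 'M[C]_(m, k + m)) (A : 'M[C]_(k, k + m)) : Prop :=
  \rank (A :&: B)%MS != 0%N.

(* t.L : the image of the row space of Lm under t.e_j = t^j e_j (j = 1..n) *)
Definition tact (m n : nat) (t : R) (Lm : 'M[R]_(m, n)) : 'M[R]_(m, n) :=
  \matrix_(i, j) (Lm i j * t ^+ (j.+1)).

Definition cmx (p q : nat) (B : 'M[R]_(p, q)) : 'M[C]_(p, q) := map_mx cR B.

(* ---- differentials (first-order coefficient along A + eps V) ---- *)
Definition pmx (p q : nat) (A : 'M[C]_(p, q)) : 'M[{poly C}]_(p, q) :=
  map_mx (fun x => x%:P) A.

Definition dplucker (k n : nat) (b : {ffun 'I_k -> 'I_n}) (A V : 'M[C]_(k, n)) : C :=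
  (\det (colsub b (pmx A + 'X *: pmx V)))`_1.

(* d (det [A ; B]) at A in direction V; Omega(B) is the hyperplane section det[A;B] = 0 *)
Definition ddet (k m : nat) (B : 'M[C]_(m, k + m)) (A V : 'M[C]_(k, k + m)) : C :=
  (\det (col_mx (pmx A + 'X *: pmx V) (pmx B)))`_1.

Definition grad (k n : nat) (f : 'M[C]_(k, n) -> C) : 'rV[C]_(k * n) :=
  \row_(i < k * n) f (vec_mx (delta_mx 0 i)).

(* Span of the differentials cutting out the tangent space of Omega_alpha at A.
   Tangent space of Gr(k,n) at K = rowspace A is M_{k,n} / (M_k A), of dimension
   k*m; all these differentials vanish on M_k A at points of Omega_alpha. *)
Definition schubert_conormal (k m : nat) (a : {ffun 'I_k -> 'I_(k + m)})
    (A : 'M[C]_(k, k + m)) : 'M[C]_(k * (k + m)) :=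
  (\sum_(b | incr b && ~~ bruhat_le b a) <<grad (dplucker b A)>>)%MS.

Definition omegaM_conormal (k m : nat) (B : 'M[C]_(m, k + m))
    (A : 'M[C]_(k, k + m)) : 'M[C]_(k * (k + m)) :=
  <<grad (ddet B A)>>%MS.

(* Transversality at the point rowspace A of Omega_alpha with the hypersurfaces
   Omega(B_i), i < N (B indexed by 'I_M, only i < N used) (N = |alpha|):
   - Omega_alpha is smooth at A (its tangent space has dimension |alpha|),
   - each Omega(B_i) is smooth at A (tangent space of codimension 1),
   - the tangent spaces intersect in 0 (conormal spaces span everything). *)
Definition transverse_at (k m M N : nat) (a : {ffun 'I_k -> 'I_(k + m)})
    (B : 'I_M -> 'M[C]_(m, k + m)) (A : 'M[C]_(k, k + m)) : Prop :=
  [/\ \rank (schubert_conormal a A) = (k * m - weight a)%N,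
      forall i : 'I_M, (i < N)%N -> \rank (omegaM_conormal (B i) A) = 1%N &
      \rank (schubert_conormal a A + \sum_(i < M | (i < N)%N) omegaM_conormal (B i) A)%MS
        = (k * m)%N].

End Geometry.

(* Main.v *)
Require Import Defs.
From HB Require Import structures.
From mathcomp Require Import all_boot all_order all_algebra all_fingroup zify ring lra.
From mathcomp Require Import complex.
From mathcomp Require Import reals.
From mathcomp Require Import boolp classical_sets functions filter topology.
From mathcomp Require Import interval_inference normedtype sequences.
Set Implicit Arguments. Unset Strict Implicit. Unset Printing Implicit Defensive.
Import Order.TTheory GRing.Theory Num.Theory.
Import numFieldNormedType.Exports.
Local Open Scope ring_scope.

(** The hyperplane sections degenerate: [det [A; t.L]] expands by Laplace as
    [sum_b c_b t^(-|b|) p_b(A)] up to a nonzero factor, with all [c_b <> 0], so on the Schubert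
    variety of [a] its leading term for [t -> 0] is [p_a], and [p_a = 0] cuts that variety in the
    union of the Schubert varieties of the [b] covered by [a], with multiplicity one.

    The [t_i] are chosen one after the other, each small with respect to the previous ones, along
    an ultrafilter [U] finer than the punctured right neighbourhoods of 0. Every family of solutions has a limit
    along [U] once normalized by its largest Pluecker coordinate; this limit is a solution for some
    [b] covered by [a]. Conversely, near a real transverse solution [K0] for [b], the chart
    [p_b <> 0] of the Schubert variety of [a] is an affine space in which the Jacobian matrix of
    the degenerate system is invertible at [K0]; Newton's iteration yields a real solution tending
    to [K0], and the matrix of difference quotients of the equations, being invertible
    near [K0], shows that this solution is the only one nearby, even over the complex numbers, and
    that it is transverse. Counting gives [d(a) = sum_b d(b)]. *)

(** * Sequences and the Bruhat order *)

Section Combinatorics.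
Variables k n : nat.
Implicit Types a b c e : {ffun 'I_k -> 'I_n}.

(** No degree theory is at hand to bound the number of complex solutions, so completeness of the
    list of branches has to come from limits. Two properties carried through the induction make this
    work. Emptiness of the intersections of negative expected dimension ([no_small]) confines the
    solutions for a sequence of weight [N] to its open cell, hence to a chart, and forces limits
    into the cells of covered sequences. Transversality at every solution makes the limit system in
    the chart invertible. Multiplicity one has an elementary source: a cover raises a single entry
    of [b] by one, so that in the chart [p_b <> 0] the coordinate [p_a] is, up to sign, a single
    matrix entry. The ultrafilter replaces the choice of subsequences or of algebraic curves: a
    claim about all solutions that does not hold for [U]-almost all [x] fails for [U]-almost all
    [x], and choosing counterexamples gives a family to which the limit theorem applies. Only
    finitely many sequences exist, so at each stage one parameter serves all of them. *)

Lemma incrP a : reflect {homo a : i j / (i < j)%N} (incr a).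
Proof.
apply: (iffP 'forall_forallP) => H i j; first by move=> ij; have /implyP := H i j; apply.
by apply/implyP; apply: H.
Qed.

Lemma bruhatP b a : reflect (forall j, (b j <= a j)%N) (bruhat_le b a).
Proof. exact: forallP. Qed.

Lemma incr_le a (i j : 'I_k) : incr a -> (i <= j)%N -> (a i <= a j)%N.
Proof.
move=> /incrP ia; rewrite leq_eqVlt => /orP[/eqP/val_inj->//|/ia]; exact: ltnW.
Qed.

Lemma incr_inj a : incr a -> injective a.
Proof.
move=> /incrP ia i j eij; apply: val_inj; case: (ltngtP i j) => // /ia;
by rewrite eij ltnn.
Qed.

Lemma incr_ge a (i : 'I_k) : incr a -> (i <= a i)%N.
Proof.
move=> ia; case: i => i; elim: i => [//|i IH] ltik /=.
have ltik' : (i < k)%N := ltnW ltik.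
apply: leq_ltn_trans (IH ltik') _; exact: (incrP _ ia).
Qed.

Lemma bruhat_refl a : bruhat_le a a. Proof. exact/bruhatP. Qed.

(** The truncated subtraction in [weight] loses nothing on increasing sequences, so that weights can
    be compared through plain sums of entries. *)
Lemma weight_sum a : incr a -> (weight a + \sum_(j < k) j)%N = (\sum_(j < k) a j)%N.
Proof.
by move=> ia; rewrite -big_split; apply: eq_bigr => j _; rewrite /= subnK // incr_ge.
Qed.

Lemma weight_le b a : bruhat_le b a -> (weight b <= weight a)%N.
Proof. by move=> /bruhatP ba; apply: leq_sum => j _; apply: leq_sub2r. Qed.

(** Termwise inequalities whose sums agree are equalities. Sequences are identified below through
    their weights in this way. *)
Lemma bruhat_weight_eq b a : incr b -> incr a -> bruhat_le b a ->
  (weight a <= weight b)%N -> b = a.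
Proof.
move=> ib ia /bruhatP ba wab; apply/ffunP => j; apply: val_inj => /=.
have: (\sum_(j < k) a j <= \sum_(j < k) b j)%N by rewrite -!weight_sum // leq_add2r.
rewrite (bigD1 j) //= [leqRHS](bigD1 j) //=.
have: (\sum_(i < k | i != j) b i <= \sum_(i < k | i != j) a i)%N by apply: leq_sum.
have := ba j; move: (\sum_(i < k | _) a i)%N (\sum_(i < k | _) b i)%N (nat_of_ord (a j)) (nat_of_ord (b j)) => x y z w; lia.
Qed.

Lemma sort_inj (g : 'I_k -> 'I_n) : injective g ->
  exists2 b, incr b & exists s : 'S_k, forall i, b i = g (s i).
Proof.
move=> ginj.
pose r (x y : 'I_n) := (x <= y)%N.
have tot : total r by move=> x y; exact: leq_total.
pose t := [tuple g i | i < k].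
have pe : perm_eq (sort r t) t by rewrite perm_sort.
have ss : size (sort r t) == k by rewrite size_sort size_tuple.
have /tuple_permP[s es] : perm_eq (Tuple ss) t by [].
exists [ffun i => g (s i)]; last by exists s => i; rewrite ffunE.
apply/incrP => i j ij.
have nthE (l : 'I_k) : g (s l) = nth (g l) (sort r t) l.
  have -> : sort r t = Tuple ss by [].
  by rewrite es (nth_map l) ?size_enum_ord // nth_ord_enum tnth_mktuple.
have us : uniq (sort r t).
  by rewrite sort_uniq map_inj_uniq ?enum_uniq //.
have : sorted ltn [seq val x | x <- sort r t].
  rewrite ltn_sorted_uniq_leq map_inj_uniq ?us //=; last exact: val_inj.
  rewrite sorted_map; exact: sort_sorted.
move/(sorted_ltn_nth ltn_trans 0)/(_ i j); rewrite !inE size_map (eqP ss) !ltn_ord.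
move=> /(_ isT isT ij).
by rewrite !ffunE !nthE !(nth_map (g i)) ?(eqP ss) // (set_nth_default (g i)) // (eqP ss).
Qed.

(** Otherwise the [j + 1] indices up to [j] would inject into the [j] indices below it. *)
Lemma perm_pigeon (s : 'I_k -> 'I_k) (j : 'I_k) : injective s ->
  ~ (forall i : 'I_k, (i <= j)%N -> (s i < j)%N).
Proof.
move=> sinj H.
have H' (i : 'I_j.+1) : (s (widen_ord (ltn_ord j) i) < j)%N by apply: H; rewrite /= -ltnS.
have : injective (fun i => Ordinal (H' i)).
  by move=> x y [] /val_inj/sinj [] /val_inj.
by move/leq_card; rewrite !card_ord ltnn.
Qed.

(* [interlaced b a]: the chart [p_b <> 0] of the Schubert variety of [a] is an affine space. *)
Definition interlaced b a :=
  bruhat_le b a && [forall i : 'I_k, forall j : 'I_k, (i < j)%N ==> (a i < b j)%N].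

Lemma interlacedP b a : reflect
  ((forall j, (b j <= a j)%N) /\ (forall i j : 'I_k, (i < j)%N -> (a i < b j)%N))
  (interlaced b a).
Proof.
apply: (iffP andP) => [[/bruhatP h /'forall_forallP H]|[/bruhatP h H]]; split => //.
  by move=> i j ij; have /implyP := H i j; apply.
by apply/'forall_forallP => i j; apply/implyP/H.
Qed.

Lemma interlaced_refl a : incr a -> interlaced a a.
Proof. by move=> /incrP ia; apply/interlacedP. Qed.

(** Raising by one the entry of [b] at the last index where [b] and [a] differ gives an increasing
    sequence between them, which must be [a]. Hence a cover changes a single entry, by one. *)
Lemma covers_interlaced b a : covers b a -> interlaced b a /\ weight a = (weight b).+1.
Proof.
case/and5P => ib ia ba nba /existsPn nex.
have [j0 lt0] : exists j, (b j < a j)%N.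
  case: (pickP (fun j : 'I_k => (b j < a j)%N)) => [j|ge]; first by exists j.
  case/eqP: nba; apply/ffunP => j; apply: val_inj; apply/eqP.
  by rewrite eqn_leq (bruhatP _ _ ba) leqNgt ge.
(* At the last such index the raised entry is at most [a j], and the later entries agree with those
   of [a], so the sequence stays increasing. *)
case: (arg_maxnP (P := fun j : 'I_k => (b j < a j)%N) val lt0) => j ltj jmax {j0 lt0}.
have eqj (i : 'I_k) : (j < i)%N -> b i = a i :> nat.
  move=> ji; apply/eqP; rewrite eqn_leq (bruhatP _ _ ba) leqNgt.
  by apply/negP => /jmax /=; lia.
have bn : ((b j).+1 < n)%N by apply: leq_ltn_trans (ltn_ord (a j)).
pose c : {ffun 'I_k -> 'I_n} := [ffun i => if i == j then Ordinal bn else b i].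
have cE (i : 'I_k) : c i = (b i + (i == j))%N :> nat.
  by rewrite ffunE; case: eqP => [->|]; rewrite /= ?addn1 ?addn0.
have ic : incr c.
  apply/incrP => x y xy; rewrite !cE; have := incrP _ ib x y xy.
  case: (x =P j) => [xj|_]; case: (y =P j) => [yj|_] //=; try lia.
  subst x; have := eqj y xy; have := incrP _ ia j y xy; lia.
have ec : c = a.
  apply/eqP; apply: contraT => nca; have := nex c.
  have -> : c != b.
    by apply/eqP => /ffunP/(_ j)/(congr1 val) /=; rewrite cE eqxx; lia.
  rewrite ic nca /=; have -> : bruhat_le b c by apply/bruhatP => i; rewrite cE leq_addr.
  have -> // : bruhat_le c a.
  apply/bruhatP => i; rewrite cE; case: eqP => [->|_] /=; first by rewrite addn1.
  by rewrite addn0 (bruhatP _ _ ba).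
split.
  apply/interlacedP; split; first exact/bruhatP.
  move=> x y xy; have := incrP _ ib x y xy; rewrite -ec cE; case: (x =P j) => [xj|_]; last by lia.
  by subst x; have := incrP _ ia j y xy; rewrite -(eqj y xy) -{1}ec cE eqxx /=.
have := weight_sum ia; have := weight_sum ib.
have -> : (\sum_(j < k) a j = \sum_(j < k) b j + 1)%N.
  rewrite -ec (eq_bigr (fun i => (b i + (i == j))%N)) // big_split /=.
  congr addn; rewrite (bigD1 j) //= big1 ?eqxx // => i /negbTE->//.
lia.
Qed.

(** The weight is strictly monotone, so a jump of one leaves no room in between. *)
Lemma weight_covers b a : incr b -> incr a -> bruhat_le b a ->
  weight a = (weight b).+1 -> covers b a.
Proof.
move=> ib ia ba w; apply/and5P; split => //.
  by apply/eqP => eab; move: w; rewrite eab; lia.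
apply/negP => /existsP[c /and5P[ic bc ca ncb nca]].
case: (leqP (weight c) (weight b)) => h.
  by case/eqP: ncb; rewrite (bruhat_weight_eq ib ic bc).
by case/eqP: nca; rewrite (bruhat_weight_eq ic ia ca) // w.
Qed.

(** Positions of the free entries of a matrix of the chart: the columns [b] form the identity and
    row [i] vanishes beyond column [a i]. *)
Definition chart_pos b a : {set 'I_k * 'I_n} :=
  [set p : 'I_k * 'I_n | (p.2 <= a p.1)%N && (p.2 \notin codom b)].

(** Of the [a i + 1] columns up to [a i], interlacing makes exactly [b 0, ..., b i] pivots, so
    [a i - i] positions remain in row [i]. The total is the dimension of the Schubert variety. *)
Lemma card_chart_pos b a : incr b -> incr a -> interlaced b a -> #|chart_pos b a| = weight a.
Proof.
move=> ib ia /interlacedP[ba H].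
rewrite -sum1_card (eq_bigl (fun p : 'I_k * 'I_n => xpredT p.1 && ((p.2 <= a p.1)%N && (p.2 \notin codom b)))); last first.
  by move=> p; rewrite inE.
rewrite -(pair_big_dep xpredT (fun i (c : 'I_n) => (c <= a i)%N && (c \notin codom b)) (fun _ _ => 1%N)) /=.
apply: eq_bigr => i _; rewrite sum1_card.
have cle : #|[pred c : 'I_n | (c <= a i)%N]| = (a i).+1.
  rewrite -[RHS]card_ord.
  rewrite -(card_codom (f := fun x : 'I_(a i).+1 => widen_ord (ltn_ord (a i)) x)); last first.
    by move=> x y [] /val_inj.
  apply: eq_card => c; rewrite inE; apply/idP/codomP => [ca|[x ->]].
    by exists (Ordinal (ca : (c < (a i).+1)%N)); apply: val_inj.
  by rewrite /= -ltnS.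
have cb : #|[pred c : 'I_n | (c <= a i)%N && (c \in codom b)]| = i.+1.
  rewrite -[RHS]card_ord.
  rewrite -(card_codom (f := fun x : 'I_i.+1 => b (widen_ord (ltn_ord i) x))); last first.
    by move=> x y /(incr_inj ib) [] /val_inj.
  apply: eq_card => c; rewrite inE; apply/andP/codomP => [[ca /codomP[j ej]]|[x ->]].
    have ji : (j < i.+1)%N.
      by rewrite ltnS leqNgt; apply/negP => /H; rewrite -ej; lia.
    by exists (Ordinal ji); rewrite ej; congr (b _); apply: val_inj.
  split; last exact: codom_f.
  by apply: leq_trans (ba _) (incr_le ia _); rewrite /= -ltnS.
have := cardID [pred c | c \in codom b] [pred c : 'I_n | (c <= a i)%N].
rewrite cle -[RHS in _ -> _ = RHS]/(a i - i)%N.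
set x := #|_|; set y := #|_|; set z := #|_|.
have -> : x = i.+1 by rewrite -cb; apply: eq_card => c; rewrite !inE.
have -> : z = y by apply: eq_card => c; rewrite !inE andbC.
lia.
Qed.

(** If [e <= a], the first [i + 1] entries of [e] are at most [a i]; none of them is [c], and by
    interlacing they all come from entries of [b] with index below [i], against the pigeonhole
    principle. *)
Lemma exchange_not_le b a (g : 'I_k -> 'I_n) (i : 'I_k) (c : 'I_n) e (s : 'S_k) :
  incr a -> interlaced b a ->
  (forall j, g j = if j == i then c else b j) -> (a i < c)%N ->
  (forall j, e j = g (s j)) -> ~~ bruhat_le e a.
Proof.
move=> ia /interlacedP[ba H] gE ac eE; apply/negP => /bruhatP ea.
apply: (@perm_pigeon s i perm_inj) => j ji.
have : (g (s j) <= a i)%N by rewrite -eE; apply: leq_trans (ea j) (incr_le ia ji).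
rewrite gE; case: eqP => [_|/eqP ns]; first by lia.
by case: (ltngtP (s j) i) => // [/H|/val_inj/eqP]; [lia|rewrite (negbTE ns)].
Qed.

(** Sorting preserves domination: if [a j < e j], then [s] would send all indices up to [j] below
    [j]. *)
Lemma perm_dominated e a (s : 'S_k) : incr e -> incr a ->
  (forall i, (e (s i) <= a i)%N) -> bruhat_le e a.
Proof.
move=> ie ia H; apply/bruhatP => j; rewrite leqNgt; apply/negP => lt.
apply: (@perm_pigeon s j perm_inj) => i ij; rewrite ltnNge; apply/negP => js.
have := H i; have := incr_le ia ij; have := incr_le ie js; lia.
Qed.

End Combinatorics.

(** * Maximal minors and their difference quotients *)

Section Minors.
Variable K : comNzRingType.

Definition mixrow k n (i : 'I_k) (A' V A : 'M[K]_(k, n)) : 'M[K]_(k, n) :=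
  \matrix_(a, c) if (a < i)%N then A' a c else if a == i then V a c else A a c.

(* A difference quotient of the minor, by telescoping over the rows ([minor_diff]); for [A = A'] it is
   the derivative in the direction [V] ([minor_quot_coef1]). *)
Definition minor_quot k n (g : 'I_k -> 'I_n) (A A' V : 'M[K]_(k, n)) : K :=
  \sum_i \det (colsub g (mixrow i A' V A)).

Lemma det_mixrow_linear k (i : 'I_k) (A A' V W : 'M[K]_k) x :
  \det (mixrow i A' (x *: V + W) A) = x * \det (mixrow i A' V A) + \det (mixrow i A' W A).
Proof.
rewrite -[\det (mixrow i A' W A)]mul1r; apply: (determinant_multilinear (i0 := i)).
- by apply/rowP => c; rewrite !mxE ltnn eqxx !mul1r.
- by apply/matrixP => a c; rewrite !mxE; case: ifP => // _; rewrite eq_sym (negbTE (neq_lift _ _)).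
- by apply/matrixP => a c; rewrite !mxE; case: ifP => // _; rewrite eq_sym (negbTE (neq_lift _ _)).
Qed.

Lemma colsub_mixrow k n (g : 'I_k -> 'I_n) i (A' V A : 'M[K]_(k, n)) :
  colsub g (mixrow i A' V A) = mixrow i (colsub g A') (colsub g V) (colsub g A).
Proof. by apply/matrixP => a c; rewrite !mxE. Qed.

Lemma det_diff k (A A' : 'M[K]_k) :
  \det A - \det A' = \sum_i \det (mixrow i A' (A - A') A).
Proof.
pose D (i : nat) := \det (\matrix_(a < k, c < k) if (a < i)%N then A' a c else A a c).
have D0 : D 0%N = \det A by congr (\det _); apply/matrixP => a c; rewrite !mxE.
have Dk : D k = \det A'.
  by congr (\det _); apply/matrixP => a c; rewrite !mxE ltn_ord.
rewrite -D0 -Dk -opprB -(telescope_sumr _ (leq0n k)) big_mkord -sumrN.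
apply: eq_bigr => i _; rewrite opprB; apply/eqP; rewrite subr_eq; apply/eqP.
rewrite -[\det _]mul1r -[D i.+1]mul1r; apply: (determinant_multilinear (i0 := i)).
- by apply/rowP => c; rewrite !mxE ltnn eqxx ltnSn !mul1r subrK.
- apply/matrixP => a c; rewrite !mxE; case: ifP => // _.
  by rewrite eq_sym (negbTE (neq_lift _ _)).
- apply/matrixP => a c; rewrite !mxE ltnS leq_eqVlt.
  by rewrite /= eq_sym (negbTE (neq_bump _ _)).
Qed.

Lemma minor_diff k n (g : 'I_k -> 'I_n) (A A' : 'M[K]_(k, n)) :
  \det (colsub g A) - \det (colsub g A') = minor_quot g A A' (A - A').
Proof.
rewrite det_diff; apply: eq_bigr => i _; rewrite colsub_mixrow.
by congr (\det (mixrow _ _ _ _)); apply/matrixP => a c; rewrite !mxE.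
Qed.

Lemma minor_quot_linear k n (g : 'I_k -> 'I_n) (A A' : 'M[K]_(k, n)) x V W :
  minor_quot g A A' (x *: V + W) = x * minor_quot g A A' V + minor_quot g A A' W.
Proof.
rewrite /minor_quot mulr_sumr -big_split; apply: eq_bigr => i _ /=.
rewrite !colsub_mixrow -det_mixrow_linear; congr (\det (mixrow _ _ _ _)).
by apply/matrixP => a c; rewrite !mxE.
Qed.

Lemma colsub_mulmx p q n k (g : 'I_k -> 'I_n) (U : 'M[K]_(p, q)) (A : 'M[K]_(q, n)) :
  colsub g (U *m A) = U *m colsub g A.
Proof. by apply/matrixP => a c; rewrite !mxE; apply: eq_bigr => j _; rewrite !mxE. Qed.

Lemma det_colsub_perm k n (g : 'I_k -> 'I_n) (b : 'I_k -> 'I_n) (s : 'S_k) (A : 'M[K]_(k, n)) :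
  (forall i, b i = g (s i)) -> \det (colsub b A) = (-1) ^+ s * \det (colsub g A).
Proof.
move=> E; have -> : colsub b A = col_perm s (colsub g A).
  by apply/matrixP => a c; rewrite !mxE E.
by rewrite col_permE det_mulmx det_perm odd_permV mulrC.
Qed.

Lemma minor_quot_perm k n (g : 'I_k -> 'I_n) (b : 'I_k -> 'I_n) (s : 'S_k) (A A' V : 'M[K]_(k, n)) :
  (forall i, b i = g (s i)) -> minor_quot b A A' V = (-1) ^+ s * minor_quot g A A' V.
Proof. by move=> E; rewrite mulr_sumr; apply: eq_bigr => i _; rewrite (det_colsub_perm _ E). Qed.

(** Expansion along row [i] leaves one term, so the entries of a normalized matrix are themselves
    minors. The new column takes the place of the old one, which avoids a sign; [det_colsub_perm]
    brings it in when the columns are sorted. *)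
Lemma det_exchange k n (b g : 'I_k -> 'I_n) (i : 'I_k) (c : 'I_n) (A : 'M[K]_(k, n)) :
  colsub b A = 1%:M -> (forall j, g j = if j == i then c else b j) ->
  \det (colsub g A) = A i c.
Proof.
move=> A1 gE; have AE x j : A x (b j) = (x == j)%:R.
  by move/matrixP/(_ x j): A1; rewrite !mxE.
rewrite (expand_det_row _ i) (bigD1 i) //= big1 => [|j /negbTE ji]; last first.
  by rewrite !mxE gE ji AE eq_sym ji mul0r.
rewrite addr0 !mxE gE eqxx /cofactor.
suff -> : row' i (col' i (colsub g A)) = 1%:M.
  by rewrite det1 mulr1 -signr_odd addnn odd_double mulr1.
by apply/matrixP => x y; rewrite !mxE gE eq_sym (negbTE (neq_lift _ _)) AE (inj_eq lift_inj).
Qed.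

(** The echelon shape: in a chart, the equations of the Schubert variety of [a] become these linear
    conditions ([chart_lowtri]). *)
Definition lowtri k n (a : {ffun 'I_k -> 'I_n}) (A : 'M[K]_(k, n)) :=
  forall i (c : 'I_n), (a i < c)%N -> A i c = 0.

(** A term of the determinant that avoids the forced zeros has [e (s i) <= a i] for all [i], whence
    [e <= a] after sorting. *)
Lemma det_lowtri k n (a e : {ffun 'I_k -> 'I_n}) (A : 'M[K]_(k, n)) :
  incr a -> incr e -> lowtri a A -> ~~ bruhat_le e a -> \det (colsub e A) = 0.
Proof.
move=> ia ie lA nle; rewrite /determinant big1 // => s _.
case: (pickP (fun i => (a i < e (s i))%N)) => [i lt|H].
  by rewrite (bigD1 i) //= mxE lA // mul0r mulr0.
case/negP: nle; apply: (perm_dominated (s := s)) => // i.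
by rewrite leqNgt H.
Qed.

Lemma minor_quot_lowtri k n (a e : {ffun 'I_k -> 'I_n}) (A A' V : 'M[K]_(k, n)) :
  incr a -> incr e -> lowtri a A -> lowtri a A' -> lowtri a V -> ~~ bruhat_le e a ->
  minor_quot e A A' V = 0.
Proof.
move=> ia ie lA lA' lV nle; rewrite /minor_quot big1 // => i _.
apply: (det_lowtri ia) => // j c jc; rewrite mxE.
by case: ifP => _; [exact: lA'|case: ifP => _; [exact: lV|exact: lA]].
Qed.

End Minors.

(** * Derivatives of minors and Laplace expansion *)

Section MinorDerivative.
Variable K : comNzRingType.

Lemma det_linear_coef1 k (A V : 'M[K]_k) :
  (\det (map_mx polyC A + 'X *: map_mx polyC V))`_1 = \sum_i \det (mixrow i A V A).
Proof.
set P := map_mx polyC A; set Q := map_mx polyC V.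
(* The telescoping formula over the polynomial ring: each summand has one row in the increment
   ['X *: Q], which yields one factor ['X]. Evaluation of the cofactor of ['X] at 0 then gives the
   coefficient. *)
have E : \det (P + 'X *: Q) = 'X * (\sum_i \det (mixrow i P Q (P + 'X *: Q))) + \det P.
  apply/eqP; rewrite -subr_eq det_diff mulr_sumr; apply/eqP; apply: eq_bigr => i _.
  rewrite [P + _]addrC addrK.
  have := det_mixrow_linear i ('X *: Q + P) P Q 0 'X; rewrite addr0 => ->.
  rewrite [X in _ + X](_ : _ = 0) ?addr0 //.
  rewrite (expand_det_row _ i) big1 // => j _.
  by rewrite !mxE ltnn eqxx mul0r.
rewrite E coefD coefXM /= det_map_mx coefC addr0 -horner_coef0 horner_sum.
apply: eq_bigr => i _; rewrite -[LHS]/(horner_eval 0 _) -det_map_mx; congr (\det _).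
apply/matrixP => a c; rewrite !mxE.
by do 2?case: ifP => _; rewrite /= /horner_eval ?hornerE /= ?mul0r ?addr0.
Qed.

Lemma minor_quot_coef1 k n (g : 'I_k -> 'I_n) (A V : 'M[K]_(k, n)) :
  minor_quot g A A V = (\det (colsub g (map_mx polyC A + 'X *: map_mx polyC V)))`_1.
Proof.
have -> : colsub g (map_mx polyC A + 'X *: map_mx polyC V) =
    map_mx polyC (colsub g A) + 'X *: map_mx polyC (colsub g V).
  by apply/matrixP => a c; rewrite !mxE.
by rewrite det_linear_coef1; apply: eq_bigr => i _; rewrite colsub_mixrow.
Qed.

Lemma minor_quot_mulmx k n (g : 'I_k -> 'I_n) (U : 'M[K]_k) (A V : 'M[K]_(k, n)) :
  minor_quot g (U *m A) (U *m A) (U *m V) = \det U * minor_quot g A A V.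
Proof.
rewrite !minor_quot_coef1 !map_mxM scalemxAr -mulmxDr colsub_mulmx det_mulmx det_map_mx.
by rewrite coefCM.
Qed.

(** The trace of [M], as a first-order coefficient: along the vertical direction [M *m A] it
    multiplies all minors alike. *)
Definition dtrace k (M : 'M[K]_k) := (\det (1%:M + 'X *: map_mx polyC M))`_1.

Lemma minor_quot_vertical k n (g : 'I_k -> 'I_n) (M : 'M[K]_k) (A : 'M[K]_(k, n)) :
  minor_quot g A A (M *m A) = dtrace M * \det (colsub g A).
Proof.
rewrite minor_quot_coef1 map_mxM scalemxAl -{1}[map_mx polyC A]mul1mx -mulmxDl colsub_mulmx.
have -> : colsub g (map_mx polyC A) = map_mx polyC (colsub g A).
  by apply/matrixP => a c; rewrite !mxE.
by rewrite det_mulmx det_map_mx coefMC.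
Qed.

Lemma minor_quot_exchange k n (b g : 'I_k -> 'I_n) (i : 'I_k) (c : 'I_n) (A V : 'M[K]_(k, n)) :
  colsub b A = 1%:M -> colsub b V = 0 -> (forall j, g j = if j == i then c else b j) ->
  minor_quot g A A V = V i c.
Proof.
move=> A1 V0 gE; rewrite minor_quot_coef1 (det_exchange _ gE).
  by rewrite !mxE coefD coefXM !coefC /= add0r.
apply/matrixP => x y; move/matrixP/(_ x y): A1; move/matrixP/(_ x y): V0.
by rewrite !mxE => -> ->; rewrite mulr0 addr0 -polyC_natr.
Qed.

(** Multilinearity in the top rows: [f] chooses one unit vector for each row of [A], and [B] is left
    alone. *)
Lemma det_col_mx_rows k m (A : 'M[K]_(k, k + m)) (B : 'M[K]_(m, k + m)) :
  \det (col_mx A B) = \sum_(f : {ffun 'I_k -> 'I_(k + m)})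
    (\prod_i A i (f i)) * \det (col_mx (rowsub f 1%:M) B).
Proof.
transitivity (\sum_(s : 'S_(k + m)) (-1) ^+ s *
   ((\prod_i A i (s (lshift m i))) * \prod_j B j (s (rshift k j)))).
  apply: eq_bigr => s _; rewrite big_split_ord; congr (_ * (_ * _)).
    by apply: eq_bigr => i _; rewrite col_mxEu.
  by apply: eq_bigr => i _; rewrite col_mxEd.
under [RHS]eq_bigr do rewrite /determinant mulr_sumr.
rewrite exchange_big; apply: eq_bigr => s _.
(* For each [s] the indicator retains only the [f] that agrees with [s] on the top rows. *)
transitivity (\sum_(f : {ffun 'I_k -> 'I_(k + m)}) (-1) ^+ s *
   ((\prod_i (A i (f i) * (f i == s (lshift m i))%:R)) * \prod_j B j (s (rshift k j)))).
  rewrite -mulr_sumr -mulr_suml -(bigA_distr_bigA (fun i j => A i j * (j == s (lshift m i))%:R)).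
  congr (_ * (_ * _)); apply: eq_bigr => i _.
  rewrite (bigD1 (s (lshift m i))) //= eqxx mulr1 big1 ?addr0 // => j /negbTE->.
  by rewrite mulr0.
apply: eq_bigr => f _; rewrite mulrCA big_split /= big_split_ord /= -mulrA.
congr (_ * _); rewrite mulrCA; congr (_ * (_ * _)); apply: eq_bigr => i _.
  by rewrite col_mxEu !mxE.
by rewrite col_mxEd.
Qed.

(** Up to sign, the minor of [B] in the columns complementary to [b]; the unit rows on top make it
    carry that sign by itself. *)
Definition coplucker k m (B : 'M[K]_(m, k + m)) (b : {ffun 'I_k -> 'I_(k + m)}) : K :=
  \det (col_mx (rowsub b 1%:M) B).

(** Functions with a repeated value produce two equal rows. The others factor uniquely as an
    increasing [b] composed with a permutation [s], and the sum over [s] reassembles the minor of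
    [A] in the columns [b]. *)
Lemma laplace_col_mx k m (A : 'M[K]_(k, k + m)) (B : 'M[K]_(m, k + m)) :
  \det (col_mx A B) = \sum_(b | incr b) coplucker B b * \det (colsub b A).
Proof.
rewrite det_col_mx_rows.
pose h (x : {ffun 'I_k -> 'I_(k + m)} * 'S_k) : {ffun 'I_k -> 'I_(k + m)} := [ffun i => x.1 (x.2 i)].
pose D := [set x : {ffun 'I_k -> 'I_(k + m)} * 'S_k | incr x.1].
rewrite (bigID (mem (h @: D))) /= [X in _ + X]big1 ?addr0 => [|f nf]; last first.
  have [fi|] := boolP (injectiveb f).
    case/imsetP: nf; have [b ib [s sE]] := sort_inj (injectiveP _ fi).
    exists (b, s^-1%g); first by rewrite inE.
    by apply/ffunP => i; rewrite ffunE /= sE permKV.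
  case/injectivePn => i [j nij eij].
  rewrite [\det _](determinant_alternate (i1 := lshift m i) (i2 := lshift m j)) ?mulr0 //.
  by move=> c; rewrite !col_mxEu !mxE eij.
rewrite big_imset /=; last first.
  move=> [b s] [b' s']; rewrite !inE /= => ib ib' /ffunP E.
  have E' i : b (s i) = b' (s' i) by have := E i; rewrite !ffunE.
  have bb : b = b'.
    apply: (bruhat_weight_eq ib ib').
      apply: (perm_dominated (s := (s'^-1 * s)%g)) => // i.
      by rewrite permM E' permKV.
    apply: weight_le; apply: (perm_dominated (s := (s^-1 * s')%g)) => // i.
    by rewrite permM -E' permKV.
  subst b'; congr (_, _); apply/permP => i; exact: (incr_inj ib).
rewrite (eq_bigl (fun x => incr x.1 && xpredT x.2)); last by move=> x; rewrite inE andbT.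
rewrite -(pair_big (@incr k (k + m)) xpredT (fun b s => (\prod_i A i (h (b, s) i)) * \det (col_mx (rowsub (h (b, s)) 1%:M) B))) /=.
apply: eq_bigr => b ib; rewrite /coplucker [X in _ * X]/determinant mulr_sumr.
apply: eq_bigr => s _.
(* Permuting the top rows costs the sign of [s], which is the sign needed in the expansion of the
   minor. *)
have -> : col_mx (rowsub (h (b, s)) 1%:M) B = block_mx (perm_mx s) 0 0 1%:M *m col_mx (rowsub b 1%:M) B.
  rewrite mul_block_col !mul0mx mul1mx addr0 add0r -row_permE; congr col_mx.
  by apply/matrixP => x y; rewrite !mxE ffunE.
rewrite det_mulmx det_ublock det_perm det1 mulr1.
rewrite mulrCA [RHS]mulrCA; congr (_ * _); rewrite mulrC; congr (_ * _).
by apply: eq_bigr => i _; rewrite mxE ffunE.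
Qed.

End MinorDerivative.

(** * Schubert varieties in the charts given by nonzero minors *)

Section FieldMinors.
Variable F : fieldType.
Variables k n : nat.
Implicit Types (a b e : {ffun 'I_k -> 'I_n}) (A V : 'M[F]_(k, n)).

Definition schub a A := forall e, incr e -> ~~ bruhat_le e a -> \det (colsub e A) = 0.

Lemma rank_minor A : \rank A = k -> exists2 b, incr b & \det (colsub b A) != 0.
Proof.
move=> rA; have fA : row_full A^T by rewrite /row_full mxrank_tr rA.
have [b ib [s sE]] := sort_inj (@fullrankfun_inj _ _ _ _ fA).
exists b => //; rewrite (det_colsub_perm _ sE) mulf_neq0 //.
  by rewrite signr_eq0.
rewrite -unitfE -[_ \is a _]/(_ \in unitmx) -unitmx_tr -row_full_unit.
have -> : (colsub (fullrankfun fA) A)^T = rowsub (fullrankfun fA) A^T.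
  by apply/matrixP => x y; rewrite !mxE.
by have /row_fullP := fullrowsub_full fA; move/row_fullP.
Qed.

Lemma minor_rank A (g : 'I_k -> 'I_n) : \det (colsub g A) != 0 -> \rank A = k.
Proof.
move=> dA; have U : colsub g A \in unitmx by rewrite unitmxE unitfE.
apply/eqP; rewrite eqn_leq rank_leq_row /=.
apply: leq_trans (eq_leq (esym (mxrank_unit U))) _.
have -> : colsub g A = A *m colsub g 1%:M by rewrite -colsub_mulmx mulmx1.
exact: mxrankM_maxl.
Qed.

(** When the minor [g] is nonzero, the representative of the row space of [A] whose columns [g] form
    the identity. *)
Definition normal_at (g : 'I_k -> 'I_n) A := invmx (colsub g A) *m A.

Lemma normal_atE (g : 'I_k -> 'I_n) A : \det (colsub g A) != 0 -> colsub g (normal_at g A) = 1%:M.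
Proof. by move=> dA; rewrite colsub_mulmx mulVmx // unitmxE unitfE. Qed.

Lemma normal_at_eqmx (g : 'I_k -> 'I_n) A : \det (colsub g A) != 0 -> (normal_at g A :=: A)%MS.
Proof.
move=> dA; apply: eqmxMfull; rewrite row_full_unit unitmx_inv unitmxE unitfE //.
Qed.

Lemma normal_at_mulmx (g : 'I_k -> 'I_n) A (P : 'M[F]_k) : P \in unitmx ->
  \det (colsub g A) != 0 -> normal_at g (P *m A) = normal_at g A.
Proof.
move=> Pu dA; have Au : colsub g A \in unitmx by rewrite unitmxE unitfE.
by rewrite {1}/normal_at colsub_mulmx -{2}(mulKVmx Au A) (mulmxA P) mulKmx ?unitmx_mul ?Pu.
Qed.

Lemma schub_mulmx a A (U : 'M[F]_k) : schub a A -> schub a (U *m A).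
Proof. by move=> H e ie ne; rewrite colsub_mulmx det_mulmx H ?mulr0. Qed.

Lemma lowtri_schub a A : incr a -> lowtri a A -> schub a A.
Proof. by move=> ia lA e ie; apply: (det_lowtri ia). Qed.

Definition exchange b (i : 'I_k) (c : 'I_n) (j : 'I_k) : 'I_n := if j == i then c else b j.

Lemma exchange_inj b (i : 'I_k) (c : 'I_n) : incr b -> c \notin codom b ->
  injective (exchange b i c).
Proof.
move=> ib cb x y; rewrite /exchange; case: eqP => [->|_]; case: eqP => [->|_] // E.
- by case/negP: cb; rewrite E codom_f.
- by case/negP: cb; rewrite -E codom_f.
exact: (incr_inj ib).
Qed.

(** An entry of row [i] beyond [a i] either lies in a pivot column other than [b i], where it is
    zero, or is up to sign the minor of an exchanged sequence not below [a]. *)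
Lemma chart_lowtri b a A : incr b -> incr a -> interlaced b a -> colsub b A = 1%:M ->
  schub a A -> lowtri a A.
Proof.
move=> ib ia iba A1 sA i c ic.
have [/codomP[j ej]|nc] := boolP (c \in codom b).
  move/matrixP/(_ i j): A1; rewrite !mxE ej => ->.
  case: eqP => // ij; subst j; have /interlacedP[/(_ i)] := iba; rewrite ej in ic; lia.
have [e ie [s sE]] := sort_inj (exchange_inj (i := i) ib nc).
have := sA e ie (exchange_not_le ia iba (g := exchange b i c) (fun j => erefl) ic sE).
rewrite (det_colsub_perm _ sE) (det_exchange A1 (g := exchange b i c) (fun j => erefl)).
by move/eqP; rewrite mulf_eq0 signr_eq0 /= => /eqP.
Qed.

(** The differentials of the exchanged minors are again single matrix entries, so tangent vectors
    satisfy the same linear conditions as the chart: the Schubert variety is smooth there. *)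
Lemma chart_lowtri_tangent b a A V : incr b -> incr a -> interlaced b a ->
  colsub b A = 1%:M -> colsub b V = 0 ->
  (forall e, incr e -> ~~ bruhat_le e a -> minor_quot e A A V = 0) -> lowtri a V.
Proof.
move=> ib ia iba A1 V0 sA i c ic.
have [/codomP[j ej]|nc] := boolP (c \in codom b).
  by move/matrixP/(_ i j): V0; rewrite !mxE ej.
have [e ie [s sE]] := sort_inj (exchange_inj (i := i) ib nc).
have := sA e ie (exchange_not_le ia iba (g := exchange b i c) (fun j => erefl) ic sE).
rewrite (minor_quot_perm _ _ _ sE) (minor_quot_exchange A1 V0 (g := exchange b i c) (fun j => erefl)).
by move/eqP; rewrite mulf_eq0 signr_eq0 /= => /eqP.
Qed.

(** Among the nonzero minors, take one with the largest sum of indices; a nonzero entry beyond [b i]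
    in the normal form would allow an exchange with a larger sum. *)
Lemma echelon A : \rank A = k -> exists b, [/\ incr b, \det (colsub b A) != 0 & schub b A].
Proof.
case/rank_minor => b0 ib0 d0.
have P0 : incr b0 && (\det (colsub b0 A) != 0) by rewrite ib0.
case: (arg_maxnP (P := fun b => incr b && (\det (colsub b A) != 0))
  (fun b => \sum_(j < k) b j)%N P0) => b /andP[ib db] bmax.
exists b; split => //.
have A1 := normal_atE db.
suff lA : lowtri b (normal_at b A).
  have := lowtri_schub ib lA; move=> /(schub_mulmx (colsub b A)).
  by rewrite mulKVmx // unitmxE unitfE.
move=> i c ic; have [/codomP[j ej]|nc] := boolP (c \in codom b).
  move/matrixP/(_ i j): A1; rewrite !mxE ej => ->.
  by case: eqP => // ij; subst j; rewrite ej ltnn in ic.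
have [e ie [s sE]] := sort_inj (exchange_inj (i := i) ib nc).
apply/eqP; apply: contraT => n0.
have de : \det (colsub e A) != 0.
  have : \det (colsub e (normal_at b A)) != 0.
    by rewrite (det_colsub_perm _ sE) (det_exchange A1 (g := exchange b i c) (fun j => erefl)) mulf_neq0 ?signr_eq0.
  by rewrite colsub_mulmx det_mulmx mulf_eq0 negb_or => /andP[].
have := bmax e; rewrite ie de => /(_ isT) /=.
rewrite (eq_bigr (fun x => exchange b i c (s x) : nat)); last by move=> x _; rewrite sE.
rewrite -(reindex_inj (h := s) (F := fun x => exchange b i c x : nat) (P := xpredT)) //=; last exact: perm_inj.
rewrite /exchange (bigD1 i) //= eqxx [leqRHS](bigD1 i) //=.
rewrite (eq_bigr (fun x => b x : nat)); last by move=> x /negbTE->.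
by rewrite leq_add2r; lia.
Qed.

End FieldMinors.

(** * Limits along filters and Newton's method *)

Section Tends.
Variable K : numFieldType.
Variables (T : Type) (F : set_system T).
Context {FF : Filter F}.
Local Open Scope classical_set_scope.

Definition tends (f : T -> K) (l : K) : Prop := f @ F --> l.

Lemma tends_cst l : tends (fun=> l) l. Proof. exact: cvg_cst. Qed.

Lemma tendsD f g a b : tends f a -> tends g b -> tends (fun x => f x + g x) (a + b).
Proof. exact: cvgD. Qed.

Lemma tendsB f g a b : tends f a -> tends g b -> tends (fun x => f x - g x) (a - b).
Proof. exact: cvgB. Qed.

Lemma tendsM f g a b : tends f a -> tends g b -> tends (fun x => f x * g x) (a * b).
Proof. exact: cvgM. Qed.

Lemma tends_sum (I : Type) (r : seq I) (P : pred I) (f : I -> T -> K) (l : I -> K) :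
  (forall i, tends (f i) (l i)) ->
  tends (fun x => \sum_(i <- r | P i) f i x) (\sum_(i <- r | P i) l i).
Proof.
move=> H; elim: r => [|i r IH].
  by rewrite big_nil; under eq_fun do rewrite big_nil; apply: tends_cst.
rewrite big_cons; under eq_fun do rewrite big_cons.
by case: (P i); [apply: tendsD|].
Qed.

Lemma tends_prod (I : Type) (r : seq I) (P : pred I) (f : I -> T -> K) (l : I -> K) :
  (forall i, tends (f i) (l i)) ->
  tends (fun x => \prod_(i <- r | P i) f i x) (\prod_(i <- r | P i) l i).
Proof.
move=> H; elim: r => [|i r IH].
  by rewrite big_nil; under eq_fun do rewrite big_nil; apply: tends_cst.
rewrite big_cons; under eq_fun do rewrite big_cons.
by case: (P i); [apply: tendsM|].
Qed.

Lemma tendsX f a n : tends f a -> tends (fun x => f x ^+ n) (a ^+ n).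
Proof.
move=> fa; elim: n => [|n IH].
  by rewrite expr0; under eq_fun do rewrite expr0; apply: tends_cst.
by rewrite exprS; under eq_fun do rewrite exprS; apply: tendsM.
Qed.

Definition mtends p q (M : T -> 'M[K]_(p, q)) (L : 'M[K]_(p, q)) : Prop :=
  forall i j, tends (fun x => M x i j) (L i j).

Lemma tends_det n (M : T -> 'M[K]_n) L : mtends M L -> tends (fun x => \det (M x)) (\det L).
Proof.
by move=> H; apply: tends_sum => s; apply: tendsM; [exact: tends_cst|exact: tends_prod].
Qed.

Lemma mtends_mul p q r (M : T -> 'M[K]_(p, q)) L (N : T -> 'M[K]_(q, r)) L' :
  mtends M L -> mtends N L' -> mtends (fun x => M x *m N x) (L *m L').
Proof.
move=> H H' i j; rewrite mxE; under eq_fun do rewrite mxE.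
by apply: tends_sum => k; apply: tendsM.
Qed.

Lemma mtends_cst p q (L : 'M[K]_(p, q)) : mtends (fun=> L) L.
Proof. by move=> i j; apply: tends_cst. Qed.

Lemma mtends_sub p q p' q' (f : 'I_p' -> 'I_p) (g : 'I_q' -> 'I_q) (M : T -> 'M[K]_(p, q)) L :
  mtends M L -> mtends (fun x => mxsub f g (M x)) (mxsub f g L).
Proof. by move=> H i j; rewrite mxE; under eq_fun do rewrite mxE; apply: H. Qed.

Lemma tends_minor_quot k n (g : 'I_k -> 'I_n) (A A' V : T -> 'M[K]_(k, n)) a a' v :
  mtends A a -> mtends A' a' -> mtends V v ->
  tends (fun x => minor_quot g (A x) (A' x) (V x)) (minor_quot g a a' v).
Proof.
move=> HA HA' HV; apply: tends_sum => i; apply: tends_det; apply: mtends_sub => j c.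
rewrite mxE; under eq_fun do rewrite mxE.
by case: ifP => _; [exact: HA'|case: ifP => _; [exact: HV|exact: HA]].
Qed.

Lemma tends_near f l (e : K) : tends f l -> 0 < e -> F [set x | `|l - f x| < e].
Proof. by move=> /cvgrPdist_lt H e0; apply: H. Qed.

Lemma tendsP f l : (forall e : K, 0 < e -> F [set x | `|l - f x| < e]) -> tends f l.
Proof. by move=> H; apply/cvgrPdist_lt. Qed.

Lemma tends_eq f g l : F [set x | f x = g x] -> tends f l -> tends g l.
Proof.
move=> E fl; apply: tendsP => e e0; have := tends_near fl e0.
by apply: filterS2 E => x /= ->.
Qed.

Lemma tends_ne0 f l : tends f l -> l != 0 -> F [set x | f x != 0].
Proof.
move=> fl l0; have := tends_near fl (_ : 0 < `|l|); rewrite normr_gt0 => /(_ l0).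
apply: filterS => x /=; apply: contraTneq => ->; by rewrite subr0 ltxx.
Qed.

Lemma tendsV f l : tends f l -> l != 0 -> tends (fun x => (f x)^-1) l^-1.
Proof. by move=> fl l0; apply: cvgV. Qed.

Lemma mtends_inv n (M : T -> 'M[K]_n) L : mtends M L -> L \in unitmx ->
  mtends (fun x => invmx (M x)) (invmx L).
Proof.
move=> ML; rewrite unitmxE unitfE => L0.
have dM := tends_det ML; have dM0 := tends_ne0 dM L0.
move=> i j; apply: (@tends_eq (fun x => (\det (M x))^-1 * cofactor (M x) j i)).
  apply: filterS dM0 => x /= dx.
  by rewrite /invmx unitmxE unitfE dx !mxE.
rewrite /invmx unitmxE unitfE L0 !mxE; apply: tendsM; first exact: tendsV.
apply: tendsM; [exact: tends_cst|]; apply: tends_det => a b.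
by rewrite !mxE; under eq_fun do rewrite !mxE; exact: ML.
Qed.

End Tends.

Section TendsProper.
Variable K : numFieldType.
Variables (T : Type) (F : set_system T).
Context {FF : ProperFilter F}.
Local Open Scope classical_set_scope.

Lemma tends_unique (f : T -> K) l l' : tends F f l -> tends F f l' -> l = l'.
Proof. by move=> h h'; apply: (cvg_unique (@norm_hausdorff _ _)) h h'. Qed.

Lemma tends_eq_unique (f g : T -> K) l l' : F [set x | f x = g x] ->
  tends F f l -> tends F g l' -> l = l'.
Proof. by move=> E fl; apply: tends_unique; apply: tends_eq E fl. Qed.

End TendsProper.

(** * Bounded complex families converge along an ultrafilter *)

Section ComplexLimits.
Variable R : realType.
Variables (T : Type) (F : set_system T).
Local Notation C := R[i].
Local Open Scope classical_set_scope.

Lemma real_complex_gt0 (e : C) : 0 < e -> exists2 e' : R, 0 < e' & e = cR e'.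
Proof.
case: e => a b; rewrite ltcE /= => /andP[/eqP b0 a0]; exists a => //.
by rewrite /cR; apply/eqP; rewrite eq_complex /= b0 !eqxx.
Qed.

Lemma norm_cR (x : R) : `|cR x| = cR `|x|.
Proof. by rewrite /cR normc_def /= expr0n /= addr0 sqrtr_sqr. Qed.

Lemma tends_cR (FF : Filter F) (f : T -> R) l : tends F f l -> tends F (fun x => cR (f x)) (cR l).
Proof.
move=> fl; apply: tendsP => e /real_complex_gt0[e' e0 ->].
have := @tends_near _ _ _ FF _ _ _ fl e0; apply: filterS => x /=.
by rewrite -rmorphB norm_cR ltcR.
Qed.

(** Compactness of the segment gives a cluster point; along an ultrafilter a cluster point is a
    limit. *)
Lemma ultra_bounded_real (FF : UltraFilter F) (f : T -> R) :
  F [set x | `|f x| <= 1] -> exists l, tends F f l.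
Proof.
move=> H; have Fp : ProperFilter F by exact: ultra_proper.
have FA : F [set x | `[-1, 1]%classic (f x)].
  by apply: filterS H => x; rewrite /= in_itv /= -ler_norml.
have [l [_ cl]] := @segment_compact R (-1) 1 (f @ F) (fmap_proper_filter f Fp) FA.
exists l => B Bl; have [//|nB] := in_ultra_setVsetC (f @^-1` B) FF.
by have [y []] := cl (~` B) B nB Bl.
Qed.

Lemma ultra_bounded_complex (FF : UltraFilter F) (f : T -> C) :
  F [set x | `|f x| <= 1] -> exists l, tends F f l.
Proof.
move=> H; have Fp : ProperFilter F by exact: ultra_proper.
have sq (z : C) : `|z| <= 1 -> `|complex.Re z| <= 1 /\ `|complex.Im z| <= 1.
  case: z => a b; rewrite normc_def /= -(rmorph1 (real_complex R)) lecR => h.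
  have h2 : a ^+ 2 + b ^+ 2 <= 1.
    by rewrite -[leLHS]sqr_sqrtr ?addr_ge0 ?sqr_ge0 // expr_le1 // sqrtr_ge0.
  by split; rewrite -(@expr_le1 _ 2) // real_normK ?num_real //; apply: le_trans h2;
    rewrite ?lerDl ?lerDr sqr_ge0.
have [a la] := @ultra_bounded_real FF (fun x => complex.Re (f x)) (filterS (fun x h => (sq _ h).1) H).
have [b lb] := @ultra_bounded_real FF (fun x => complex.Im (f x)) (filterS (fun x h => (sq _ h).2) H).
exists (cR a + 'i%C * cR b).
have -> : f = (fun x => cR (complex.Re (f x)) + 'i%C * cR (complex.Im (f x))).
  by apply/funext => x; rewrite -complexE.
apply: tendsD; first exact: tends_cR.
by apply: tendsM; [exact: tends_cst|exact: tends_cR].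
Qed.

End ComplexLimits.

(** * Maximum norm estimates and Newton's iteration *)

Section RowNorm.
Variable R : realType.

Lemma row_norm_le s (v : 'rV[R]_s) c : 0 <= c -> (forall j, `|v 0 j| <= c) -> `|v| <= c.
Proof.
move=> c0 H; rewrite [leLHS]/Num.norm /= mx_normrE; apply/bigmax_leP; split => // -[i j] _ /=.
by rewrite ord1.
Qed.

Lemma row_norm_ge s (v : 'rV[R]_s) j : `|v 0 j| <= `|v|.
Proof.
rewrite [leRHS]/Num.norm /= mx_normrE.
exact: (@le_bigmax _ _ _ 0 (fun ij : 'I_1 * 'I_s => `|v ij.1 ij.2|) (0, j)).
Qed.

Lemma row_norm_mul s (v : 'rV[R]_s) (M : 'M[R]_s) c : 0 <= c ->
  (forall i j, `|M i j| <= c) -> `|v *m M| <= `|v| * (c *+ s).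
Proof.
move=> c0 H; apply: row_norm_le; first by rewrite mulr_ge0 ?mulrn_wge0.
move=> j; rewrite mxE; apply: le_trans (ler_norm_sum _ _ _) _.
rewrite mulrnAr -[X in _ *+ X](card_ord s) -sumr_const.
by apply: ler_sum => i _; rewrite normrM ler_pM // row_norm_ge.
Qed.

End RowNorm.

HB.instance Definition _ (R : realType) m n :=
  Uniform_isComplete.Build (matrix R m n) (@mx_complete R m n).

Section Newton.
Variable R : realType.
Local Open Scope classical_set_scope.

(** Banach's theorem for [z - H z] on the closed ball of radius [r]. Entries of [1 - J] bounded by
    [1 / (2 (s + 1))] give the contraction ratio 1/2 in the maximum norm, with [s + 1] to allow
    [s = 0]; then [|H z0| <= r / 2] keeps the ball stable. *)
Lemma newton_fixed_point s (z0 : 'rV[R]_s) (H : 'rV[R]_s -> 'rV[R]_s)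
    (J : 'rV[R]_s -> 'rV[R]_s -> 'M[R]_s) (r : R) :
  0 < r -> (forall z z', H z - H z' = (z - z') *m J z z') ->
  (forall z z' i j, `|z - z0| <= r -> `|z' - z0| <= r ->
     `|(1%:M - J z z') i j| <= (2 * s.+1%:R)^-1) ->
  `|H z0| <= r / 2 -> exists z, H z = 0 /\ `|z - z0| <= 2 * `|H z0|.
Proof.
move=> r0 HJ Jb Hz0.
pose N z := z - H z; pose D := closed_ball_ (fun x : 'rV[R]_s => `|x|) z0 r.
have DE z : D z <-> `|z - z0| <= r by rewrite /D /closed_ball_ /= distrC.
have NN z z' : D z -> D z' -> `|N z - N z'| <= 2^-1 * `|z - z'|.
  move=> /DE Dz /DE Dz'.
  have -> : N z - N z' = (z - z') *m (1%:M - J z z').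
    by rewrite mulmxBr mulmx1 -HJ /N; move: (H z) (H z') => u w; apply/rowP => j; rewrite !mxE; ring.
  have s0 : 0 < s.+1%:R :> R by rewrite ltr0n.
  apply: (le_trans (row_norm_mul (c := (2 * s.+1%:R)^-1) _ _ _)).
  - by rewrite invr_ge0 mulr_ge0 // ltW.
  - by move=> i j; apply: Jb.
  rewrite mulrC ler_wpM2r // -[_ *+ s]mulr_natr invfM -mulrA ler_piMr // mulrC ler_pdivrMr // mul1r.
  by rewrite ler_nat.
have Dz0 : D z0 by apply/DE; rewrite subrr normr0 ltW.
have Nz0 : N z0 - z0 = - H z0 by rewrite /N addrC addKr.
have ND : {homo N : z / D z >-> D z}.
  move=> z Dz; apply/DE.
  have -> : N z - z0 = (N z - N z0) + (N z0 - z0) by rewrite addrA subrK.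
  apply: le_trans (ler_normD _ _) _; rewrite Nz0 normrN.
  have := NN z z0 Dz Dz0; have /DE := Dz; move: Hz0; lra.
have ctr : is_contraction (mkfun_fun ND).
  have h : 0 <= 2^-1 :> R by [].
  exists (NngNum h); split => /=; first by rewrite invf_lt1 // ltr1n.
  by move=> [z z'] [/= Dz Dz']; apply: NN.
have Dcl : closed D by apply: closed_closed_ball_.
have [p Dp pN] := banach_fixed_point ctr Dcl (ex_intro _ z0 Dz0).
have Hp : H p = 0.
  by move: pN => /= /esym/eqP; rewrite /mkfun /N subr_eq addrC -subr_eq subrr => /eqP.
exists p; split => //.
have := NN p z0 Dp Dz0; rewrite {1}/N Hp subr0.
have -> : p - N z0 = (p - z0) + H z0 by rewrite /N opprB addrA addrAC.
have : `|p - z0| <= `|p - z0 + H z0| + `|H z0|.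
  by rewrite -{1}[p - z0](addrK (H z0)); apply: ler_normB.
lra.
Qed.

(** Both points of a difference quotient tend to [z0] while the parameter tends to 0 from the right,
    all three independently. *)
Definition zero_right_filter s (z0 : 'rV[R]_s) : set_system (('rV[R]_s * 'rV[R]_s) * R) :=
  filter_prod (filter_prod (nbhs z0) (nbhs z0)) (0 : R)^'+.

Lemma newton_path (U : set_system R) s (z0 : 'rV[R]_s) (G : R -> 'rV[R]_s -> 'rV[R]_s)
    (J : R -> 'rV[R]_s -> 'rV[R]_s -> 'M[R]_s) (J0 : 'M[R]_s) :
  Filter U -> (0 : R)^'+ `<=` U ->
  (forall t z z', G t z - G t z' = (z - z') *m J t z z') -> J0 \in unitmx ->
  mtends (zero_right_filter z0) (fun x => J x.2 x.1.1 x.1.2) J0 ->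
  mtends U (fun t => G t z0) 0 ->
  exists z : R -> 'rV[R]_s, U [set t | G t (z t) = 0] /\ mtends U z z0.
Proof.
move=> UF UR GJ J0u Jt Gt.
(* Preconditioning by the inverse of the limit Jacobian makes the quotient matrix tend to the
   identity. *)
pose H t z := G t z *m invmx J0; pose J' t z z' := J t z z' *m invmx J0.
have HJ t z z' : H t z - H t z' = (z - z') *m J' t z z' by rewrite -mulmxBl GJ mulmxA.
have ZF : Filter (zero_right_filter z0) by apply: filter_prod_filter.
have Jt' : mtends (zero_right_filter z0) (fun x => 1%:M - J' x.2 x.1.1 x.1.2) 0.
  move=> i j; rewrite mxE -[X in tends _ _ X](subrr ((1%:M : 'M[R]_s) i j)).
  under eq_fun do rewrite [_ i j]mxE [X in _ + X]mxE.
  apply: tendsB; first exact: tends_cst.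
  rewrite -(mulmxV J0u); apply: mtends_mul => //; exact: mtends_cst.
have e0 : 0 < (2 * s.+1%:R)^-1 :> R by rewrite invr_gt0 mulr_gt0 // ltr0n.
have near1 : zero_right_filter z0 [set x | forall i j,
    `|(1%:M - J' x.2 x.1.1 x.1.2) i j| < (2 * s.+1%:R)^-1].
  have h i j := @tends_near _ _ _ ZF _ _ _ (Jt' i j) e0.
  have := filter_forall ZF (fun ij : 'I_s * 'I_s => h ij.1 ij.2).
  apply: (@filterS _ _ ZF) => x /= hx i j; have /= := hx (i, j).
  by rewrite [X in `|X - _|]mxE sub0r normrN.
have {near1} [r r0 near1] : exists2 r : R, 0 < r & forall t z z', 0 < t < r ->
    `|z - z0| <= r -> `|z' - z0| <= r -> forall i j,
    `|(1%:M - J' t z z') i j| <= (2 * s.+1%:R)^-1.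
  case: near1 => -[/= P Q] [/= [[P1 P2] /= [P1z P2z] P12]] Qr PQ.
  move: P1z P2z Qr => /nbhs_ballP[/= r1 r10 P1z] /nbhs_ballP[/= r2 r20 P2z] /nbhs_ballP[/= r3 r30 Qr].
  (* Half of the smallest radius, so that the closed balls lie in the open balls provided by the
     filters. *)
  exists (Num.min (Num.min r1 r2) r3 / 2).
    by rewrite divr_gt0 // !lt_min r10 r20 r30.
  move=> t z z' /andP[t0 tr] zr z'r i j.
  have half : Num.min (Num.min r1 r2) r3 / 2 < Num.min (Num.min r1 r2) r3.
    by rewrite ltr_pdivrMr // mulr_natr mulr2n ltrDl !lt_min r10 r20 r30.
  apply: ltW; apply: (PQ (z, z', t)) => //; split => /=; first apply: (P12 (z, z')); first split => /=.
  - apply: P1z; rewrite -ball_normE /= distrC; apply: le_lt_trans zr (lt_le_trans half _).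
    by rewrite !ge_min lexx.
  - apply: P2z; rewrite -ball_normE /= distrC; apply: le_lt_trans z'r (lt_le_trans half _).
    by rewrite !ge_min lexx orbT.
  - apply: Qr => //; rewrite -ball_normE /= sub0r normrN gtr0_norm //.
    by apply: lt_trans tr (lt_le_trans half _); rewrite !ge_min lexx orbT.
have Ht : mtends U (fun t => H t z0) 0.
  rewrite -(mul0mx _ (invmx J0)); apply: mtends_mul => //; exact: mtends_cst.
have Hsmall e : 0 < e -> U [set t | `|H t z0| < e].
  move=> e_gt0; have e2 : 0 < e / 2 by rewrite divr_gt0.
  have := filter_forall UF (fun j : 'I_s => @tends_near _ _ _ UF _ _ _ (Ht 0 j) e2).
  apply: filterS => t /= ht; apply: (@le_lt_trans _ _ (e / 2)); last first.
    by rewrite ltr_pdivrMr // mulr_natr mulr2n ltrDl.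
  apply: row_norm_le; first exact: ltW.
  by move=> j; have := ltW (ht j); rewrite mxE sub0r normrN.
pose sol t z := H t z = 0 /\ `|z - z0| <= 2 * `|H t z0|.
(* The default [z0] is taken only outside a set of [U]. The distance bound in [sol] tends to 0,
   which gives the convergence. *)
exists (fun t => xget z0 (sol t)).
have Usol : U [set t | sol t (xget z0 (sol t))].
  have U1 : U [set t | 0 < t < r].
    apply: UR; near=> t; apply/andP; split; near: t; [exact: nbhs_right_gt|exact: nbhs_right_lt].
  have r2 : 0 < r / 2 by rewrite divr_gt0.
  apply: filterS2 U1 (Hsmall _ r2) => t /= tr hr; case: xgetP => [z -> //|none].
  have [z sz] := newton_fixed_point r0 (HJ t) (fun z z' i j hz hz' => near1 t z z' tr hz hz' i j) (ltW hr).
  by case: (none z).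
split.
  apply: filterS Usol => t [/= Hz _]; move: Hz; rewrite /H => /(congr1 (mulmx^~ J0)).
  by rewrite mulmxKV // mul0mx.
move=> i j; apply: tendsP => e e_gt0; have e2 : 0 < e / 2 by rewrite divr_gt0.
apply: filterS2 Usol (Hsmall _ e2) => t [/= _ hz] hs; rewrite distrC (ord1 i).
set z := xget _ _ in hz *; have := row_norm_ge (z - z0) j; rewrite !mxE => hj.
by apply: le_lt_trans hj _; apply: le_lt_trans hz _; rewrite mulrC -ltr_pdivlMr.
Unshelve. all: by end_near.
Qed.

End Newton.

(** * Linear forms in the Pluecker coordinates *)

Section Forms.
Variable K : fieldType.
Variables k n : nat.
Local Notation seqs := {ffun 'I_k -> 'I_n}.
Implicit Types (a b e : seqs) (A V : 'M[K]_(k, n)) (S : {set 'I_k * 'I_n}) (W : nat -> seqs -> K).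

(** [phi] stands for the minors of a matrix or for their difference quotients, so that one form
    gives both an equation and its linearization. *)
Definition lform (w phi : seqs -> K) : K := \sum_(b | incr b) w b * phi b.

Definition minors A b : K := \det (colsub b A).

Definition quots A A' V b : K := minor_quot b A A' V.

Lemma lform_mulmx w (U : 'M[K]_k) A :
  lform w (minors (U *m A)) = \det U * lform w (minors A).
Proof.
rewrite /lform mulr_sumr; apply: eq_bigr => b _.
by rewrite /minors colsub_mulmx det_mulmx mulrCA.
Qed.

Lemma lform_quots_mulmx w (U : 'M[K]_k) A V :
  lform w (quots (U *m A) (U *m A) (U *m V)) = \det U * lform w (quots A A V).
Proof.
rewrite /lform mulr_sumr; apply: eq_bigr => b _.
by rewrite /quots minor_quot_mulmx mulrCA.
Qed.

Lemma lform_vertical w (M : 'M[K]_k) A :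
  lform w (quots A A (M *m A)) = dtrace M * lform w (minors A).
Proof.
rewrite /lform mulr_sumr; apply: eq_bigr => b _.
by rewrite /quots minor_quot_vertical mulrCA.
Qed.

Lemma lform_diff w A A' :
  lform w (minors A) - lform w (minors A') = lform w (quots A A' (A - A')).
Proof.
rewrite /lform -sumrB; apply: eq_bigr => b _.
by rewrite -mulrBr /quots -minor_diff.
Qed.

Lemma lform_quots_linear w A A' x V (W : 'M[K]_(k, n)) :
  lform w (quots A A' (x *: V + W)) = x * lform w (quots A A' V) + lform w (quots A A' W).
Proof.
rewrite /lform mulr_sumr -big_split; apply: eq_bigr => b _ /=.
by rewrite /quots minor_quot_linear mulrDr mulrCA.
Qed.

Lemma lform_quots0 w A A' : lform w (quots A A' 0) = 0.
Proof.
have := lform_quots_linear w A A' (-1) 0 0; rewrite scaler0 addr0 mulN1r.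
by rewrite addNr.
Qed.

Lemma lform_quotsB w A A' V (W : 'M[K]_(k, n)) :
  lform w (quots A A' (V - W)) = lform w (quots A A' V) - lform w (quots A A' W).
Proof. by rewrite -scaleN1r addrC lform_quots_linear mulN1r addrC. Qed.

Lemma lform_quots_sum w A A' s (v : 'I_s -> K) (E : 'I_s -> 'M[K]_(k, n)) :
  lform w (quots A A' (\sum_i v i *: E i)) = \sum_i v i * lform w (quots A A' (E i)).
Proof.
elim/big_rec2: _ => [|i y x _ IH]; first exact: lform_quots0.
by rewrite lform_quots_linear IH.
Qed.

Definition pos_mx (S : {set 'I_k * 'I_n}) (i : 'I_#|S|) : 'M[K]_(k, n) :=
  delta_mx (enum_val i).1 (enum_val i).2.

Definition emb (S : {set 'I_k * 'I_n}) (v : 'rV[K]_#|S|) : 'M[K]_(k, n) :=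
  \sum_i v 0 i *: pos_mx i.

Lemma pos_mxE S (i : 'I_#|S|) x c : pos_mx i x c = (enum_val i == (x, c))%:R.
Proof. by rewrite /pos_mx mxE; case: (enum_val i) => u w /=; rewrite xpair_eqE eq_sym (eq_sym c). Qed.

Lemma emb_val S (v : 'rV[K]_#|S|) i : emb v (enum_val i).1 (enum_val i).2 = v 0 i.
Proof.
rewrite /emb summxE (bigD1 i) //= big1 => [|j ji].
  by rewrite mxE pos_mxE -surjective_pairing eqxx mulr1 addr0.
by rewrite mxE pos_mxE -surjective_pairing (inj_eq enum_val_inj) (negbTE ji) mulr0.
Qed.

Lemma emb_out S (v : 'rV[K]_#|S|) x c : (x, c) \notin S -> emb v x c = 0.
Proof.
move=> ns; rewrite /emb summxE big1 // => i _; rewrite mxE pos_mxE.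
by case: eqP => [E|]; [case/negP: ns; rewrite -E enum_valP | rewrite mulr0].
Qed.

Lemma emb_inj0 S (v : 'rV[K]_#|S|) : emb v = 0 -> v = 0.
Proof. by move=> E; apply/rowP => i; rewrite -emb_val E !mxE. Qed.

Lemma embB S (v w : 'rV[K]_#|S|) : emb v - emb w = emb (v - w).
Proof. by rewrite /emb -sumrB; apply: eq_bigr => i _; rewrite !mxE scalerBl. Qed.

Lemma emb_supp S V : (forall x c, (x, c) \notin S -> V x c = 0) -> exists v : 'rV[K]_#|S|, V = emb v.
Proof.
move=> H; exists (\row_(i < #|S|) V (enum_val i).1 (enum_val i).2).
apply/matrixP => x c; have [xc|xc] := boolP ((x, c) \in S); last by rewrite H // emb_out.
by have := emb_val (\row_(i < #|S|) V (enum_val i).1 (enum_val i).2) (enum_rank_in xc (x, c));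
  rewrite mxE enum_rankK_in.
Qed.

Lemma emb_chart b a (v : 'rV[K]_#|chart_pos b a|) : colsub b (emb v) = 0 /\ lowtri a (emb v).
Proof.
split; first by apply/matrixP => x j; rewrite !mxE emb_out // inE /= codom_f andbF.
by move=> i c ic; rewrite emb_out // inE /= leqNgt ic.
Qed.

Lemma chart_emb b a V : colsub b V = 0 -> lowtri a V -> exists v : 'rV[K]_#|chart_pos b a|, V = emb v.
Proof.
move=> V0 lV; apply: emb_supp => x c; rewrite inE /= negb_and negbK -ltnNge => /orP[|]; first exact: lV.
by case/codomP => j ->; move/matrixP/(_ x j): V0; rewrite !mxE.
Qed.

(** Rows correspond to chart coordinates and columns to equations, in accordance with row vectors of
    coordinates. For [A = A'] this is the Jacobian matrix; in general it is the matrix of difference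
    quotients. *)
Definition jac (S : {set 'I_k * 'I_n}) (W : nat -> seqs -> K) A A' : 'M[K]_#|S| :=
  \matrix_(i, l) lform (W l) (quots A A' (pos_mx i)).

Lemma jac_mul S W A A' (v : 'rV[K]_#|S|) :
  v *m jac S W A A' = \row_l lform (W l) (quots A A' (emb v)).
Proof.
apply/rowP => l; rewrite !mxE /emb lform_quots_sum.
by apply: eq_bigr => i _; rewrite mxE.
Qed.

Lemma jac_unit S W A A' :
  (forall v : 'rV[K]_#|S|, (forall l : 'I_#|S|, lform (W l) (quots A A' (emb v)) = 0) -> v = 0) ->
  jac S W A A' \in unitmx.
Proof.
move=> H; rewrite -row_free_unit; apply/row_freeP.
have : row_free (jac S W A A').
  rewrite -kermx_eq0; apply/eqP/row_matrixP => i; rewrite row0; apply: H => l.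
  have : row i (kermx (jac S W A A')) *m jac S W A A' = 0 by apply/sub_kermxP; exact: row_sub.
  by rewrite jac_mul => /rowP/(_ l); rewrite !mxE.
by move/row_freeP.
Qed.

Lemma jac_unitP S W A A' (v : 'rV[K]_#|S|) : jac S W A A' \in unitmx ->
  (forall l : 'I_#|S|, lform (W l) (quots A A' (emb v)) = 0) -> v = 0.
Proof.
move=> Ju H; have : v *m jac S W A A' = 0 by rewrite jac_mul; apply/rowP => l; rewrite !mxE.
by move/(congr1 (mulmx^~ (invmx (jac S W A A')))); rewrite mulmxK // mul0mx.
Qed.

End Forms.

Section MapForms.
Variables (K K' : fieldType) (f : {rmorphism K -> K'}).
Variables k n : nat.
Local Notation seqs := {ffun 'I_k -> 'I_n}.

Lemma minors_map (A : 'M[K]_(k, n)) (b : seqs) : minors (map_mx f A) b = f (minors A b).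
Proof. by rewrite /minors -det_map_mx; congr (\det _); apply/matrixP => i j; rewrite !mxE. Qed.

Lemma quots_map (A A' V : 'M[K]_(k, n)) (b : seqs) :
  quots (map_mx f A) (map_mx f A') (map_mx f V) b = f (quots A A' V b).
Proof.
rewrite /quots /minor_quot rmorph_sum; apply: eq_bigr => i _.
rewrite -det_map_mx; congr (\det _); apply/matrixP => x y; rewrite !mxE.
by case: ifP => _; [|case: ifP => _].
Qed.

Lemma lform_map (w phi : seqs -> K) : lform (f \o w) (f \o phi) = f (lform w phi).
Proof. by rewrite /lform rmorph_sum; apply: eq_bigr => b _; rewrite /= rmorphM. Qed.

Lemma lform_minors_map w (A : 'M[K]_(k, n)) :
  lform (f \o w) (minors (map_mx f A)) = f (lform w (minors A)).
Proof. by rewrite -lform_map; apply: eq_bigr => b _; rewrite minors_map. Qed.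

Lemma jac_map (S : {set 'I_k * 'I_n}) (W : nat -> seqs -> K) (A A' : 'M[K]_(k, n)) :
  jac S (fun l => f \o W l) (map_mx f A) (map_mx f A') = map_mx f (jac S W A A').
Proof.
apply/matrixP => i l; rewrite !mxE -lform_map; apply: eq_bigr => b _ /=.
by rewrite -quots_map /pos_mx map_delta_mx.
Qed.

End MapForms.

Section TendsForms.
Variables (K : numFieldType) (T : Type) (F : set_system T).
Context {FF : Filter F}.
Variables k n : nat.
Local Notation seqs := {ffun 'I_k -> 'I_n}.

Lemma tends_minors (A : T -> 'M[K]_(k, n)) L (b : seqs) :
  mtends F A L -> tends F (fun x => minors (A x) b) (minors L b).
Proof. by move=> H; apply: tends_det; apply: mtends_sub. Qed.

Lemma tends_lform (w phi : T -> seqs -> K) w0 phi0 :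
  (forall b, tends F (fun x => w x b) (w0 b)) -> (forall b, tends F (fun x => phi x b) (phi0 b)) ->
  tends F (fun x => lform (w x) (phi x)) (lform w0 phi0).
Proof. by move=> H H'; apply: tends_sum => b; apply: tendsM. Qed.

Lemma mtends_jac (S : {set 'I_k * 'I_n}) (W : T -> nat -> seqs -> K) W0 (A A' : T -> 'M[K]_(k, n)) L L' :
  (forall l b, tends F (fun x => W x l b) (W0 l b)) -> mtends F A L -> mtends F A' L' ->
  mtends F (fun x => jac S (W x) (A x) (A' x)) (jac S W0 L L').
Proof.
move=> HW HA HA' i l; rewrite mxE; under eq_fun do rewrite mxE.
apply: tends_lform => // b; apply: tends_minor_quot => //; exact: mtends_cst.
Qed.

Lemma mtends_normal_at (g : seqs) (A : T -> 'M[K]_(k, n)) L :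
  mtends F A L -> \det (colsub g L) != 0 -> mtends F (fun x => normal_at g (A x)) (normal_at g L).
Proof.
move=> H d; apply: mtends_mul => //; apply: mtends_inv; first exact: mtends_sub.
by rewrite unitmxE unitfE.
Qed.

End TendsForms.

Section EntryBound.
Variables (K : numFieldType) (k n : nat).
Local Notation seqs := {ffun 'I_k -> 'I_n}.

(** Each entry of a normal form is zero, one, or up to sign a quotient of two minors, here with the
    largest one as denominator. This replaces compactness of the Grassmannian. *)
Lemma normal_at_le1 (A : 'M[K]_(k, n)) (g : seqs) : incr g -> minors A g != 0 ->
  (forall b : seqs, incr b -> `|minors A b| <= `|minors A g|) ->
  forall i c, `|normal_at g A i c| <= 1.
Proof.
move=> ig d0 gmax i c; have A1 := normal_atE d0.
have [/codomP[j ->]|nc] := boolP (c \in codom g).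
  have /matrixP/(_ i j) := A1; rewrite !mxE => ->.
  by case: eqP; rewrite ?normr1 ?normr0 ?ler01.
have [e ie [s sE]] := sort_inj (exchange_inj (i := i) ig nc).
have := det_colsub_perm (normal_at g A) sE.
rewrite (det_exchange A1 (g := exchange g i c) (fun j => erefl)) => /(congr1 Num.norm).
rewrite normrM normrX normrN1 expr1n mul1r => <-.
rewrite colsub_mulmx det_mulmx det_inv normrM normfV mulrC ler_pdivrMr ?normr_gt0 // mul1r.
exact: gmax.
Qed.

End EntryBound.

(** * Degeneration of the hyperplane sections *)

HB.instance Definition _ (R : realType) := GRing.RMorphism.copy (@cR R) (real_complex R).

Section Weights.
Variable R : realType.
Variables k n : nat.
Local Notation seqs := {ffun 'I_k -> 'I_n}.
Local Notation C := R[i].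
Variable c : seqs -> R.
Implicit Types a b e : seqs.

Definition wt (x : R) b : R := c b / x ^+ weight b.

(* [x ^ |a| * wt x] restricted to [b <= a]: it extends to [x = 0], where only [b = a] survives. *)
Definition wtS a (x : R) b : R := if bruhat_le b a then c b * x ^+ (weight a - weight b) else 0.

Lemma lform_wtS (K : fieldType) (f : {rmorphism R -> K}) a x (phi : seqs -> K) : x != 0 ->
  (forall e, incr e -> ~~ bruhat_le e a -> phi e = 0) ->
  lform (f \o wtS a x) phi = f (x ^+ weight a) * lform (f \o wt x) phi.
Proof.
move=> x0 H; rewrite /lform mulr_sumr; apply: eq_bigr => b ib /=.
rewrite /wtS; case: ifP => [ba|/negbT nba]; last by rewrite H // !mulr0.
rewrite mulrA -rmorphM /wt; congr (f _ * _); rewrite mulrCA; congr (_ * _).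
by rewrite expfB_cond // (negbTE x0) weight_le.
Qed.

(** At [x = 0] a term with [b <= a] survives only if its exponent is 0, that is, if [b] has the
    weight of [a]; then [b = a]. *)
Lemma lform_wtS0 (K : fieldType) (f : {rmorphism R -> K}) a (phi : seqs -> K) : incr a ->
  lform (f \o wtS a 0) phi = f (c a) * phi a.
Proof.
move=> ia; rewrite /lform (bigD1 a) //= big1 => [|b /andP[ib nba]].
  by rewrite /wtS bruhat_refl subnn expr0 mulr1 addr0.
rewrite /wtS; case: ifP => [ba|_]; last by rewrite rmorph0 mul0r.
rewrite expr0n subn_eq0; case: leqP => [w|_]; last by rewrite mulr0 rmorph0 mul0r.
by rewrite (bruhat_weight_eq ib ia ba w) eqxx in nba.
Qed.

End Weights.

Section Core.
Variable R : realType.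
Variables k n : nat.
Local Notation seqs := {ffun 'I_k -> 'I_n}.
Local Notation C := R[i].
Variable c : seqs -> R.
Hypothesis c_neq0 : forall b : seqs, incr b -> c b != 0.
Variable U : set_system R.
Hypothesis UU : UltraFilter U.
Local Open Scope classical_set_scope.
Hypothesis UR : (0 : R)^'+ `<=` U.
Implicit Types (a b e : seqs) (A V : 'M[C]_(k, n)) (t : nat -> R) (N : nat).

Let UP : ProperFilter U. Proof. exact: ultra_proper. Qed.
Let UF : Filter U. Proof. exact: filter_filter. Qed.

Lemma U_gt0 : U [set x | 0 < x].
Proof. by apply: UR; exact: nbhs_right_gt. Qed.

Lemma tends_id0 : tends U (fun x : R => x) 0.
Proof.
apply: tendsP => e e0; apply: UR; near=> x; rewrite /= sub0r normrN gtr0_norm; near: x.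
  exact: nbhs_right_lt.
exact: nbhs_right_gt.
Unshelve. all: by end_near.
Qed.

Definition pform (x : R) A : C := lform (@cR R \o wt c x) (minors A).

Definition dpform (x : R) A V : C := lform (@cR R \o wt c x) (quots A A V).

(** The number [N] of equations is independent of [weight a]: emptiness is asserted for
    [weight a < N], a count for [weight a = N], and a limit first satisfies [N] equations on a
    variety of weight at most [N.+1]. *)
Definition Sol t N a A : Prop :=
  [/\ \rank A = k, schub a A & forall l, (l < N)%N -> pform (t l) A = 0].

(* Transversality: the tangent spaces meet only in the vertical directions [M *m A]. *)
Definition Transv t N a A : Prop := forall V,
  (forall e, incr e -> ~~ bruhat_le e a -> minor_quot e A A V = 0) ->
  (forall l, (l < N)%N -> dpform (t l) A V = 0) -> exists M, V = M *m A.

Lemma Sol_mulmx t N a A (P : 'M[C]_k) : P \in unitmx -> Sol t N a A -> Sol t N a (P *m A).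
Proof.
move=> Pu [rA sA fA]; split.
- by rewrite eqmxMfull // row_full_unit.
- exact: schub_mulmx.
- by move=> l lN; rewrite /pform lform_mulmx -/(pform (t l) A) fA // mulr0.
Qed.

Lemma Transv_mulmx t N a A (P : 'M[C]_k) : P \in unitmx -> Transv t N a A -> Transv t N a (P *m A).
Proof.
move=> Pu TA V dV fV.
have d0 : \det P != 0 by rewrite -unitfE -unitmxE.
have VE : V = P *m (invmx P *m V) by rewrite mulKVmx.
have [] := TA (invmx P *m V).
- move=> e ie ne; have := dV e ie ne; rewrite VE minor_quot_mulmx -VE.
  by move/eqP; rewrite mulf_eq0 (negbTE d0) => /eqP.
- move=> l lN; have := fV l lN; rewrite /dpform VE lform_quots_mulmx -VE.
  by move/eqP; rewrite mulf_eq0 (negbTE d0) => /eqP.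
move=> M ME; exists (P *m M *m invmx P).
by rewrite VE ME -!mulmxA (mulKmx Pu).
Qed.

Lemma eqmx_unit (A B : 'M[C]_(k, n)) : \rank A = k -> (A == B)%MS ->
  exists2 P : 'M[C]_k, P \in unitmx & B = P *m A.
Proof.
move=> rA /andP[sAB /submxP[P BE]].
exists P => //; rewrite -row_full_unit -col_leq_rank.
apply: leq_trans (mxrankM_maxl P A); rewrite -BE.
by apply: leq_trans (mxrankS sAB); rewrite rA.
Qed.

Lemma Sol_eqmx t N a (A B : 'M[C]_(k, n)) : (A == B)%MS -> Sol t N a A -> Sol t N a B.
Proof. by move=> AB sA; have [rA _ _] := sA; have [P Pu ->] := eqmx_unit rA AB; apply: Sol_mulmx. Qed.

Lemma Transv_eqmx t N a (A B : 'M[C]_(k, n)) : \rank A = k -> (A == B)%MS -> Transv t N a A -> Transv t N a B.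
Proof. by move=> rA AB; have [P Pu ->] := eqmx_unit rA AB; apply: Transv_mulmx. Qed.

Lemma normal_at_eq (g : seqs) A : \det (colsub g A) != 0 -> (normal_at g A == A)%MS.
Proof. by move=> d; apply/eqmxP; apply: normal_at_eqmx. Qed.

Lemma normal_at_Sol t N a A (g : seqs) : \det (colsub g A) != 0 -> Sol t N a A -> Sol t N a (normal_at g A).
Proof. by move=> d; apply: Sol_mulmx; rewrite unitmx_inv unitmxE unitfE. Qed.

(* Degeneration: as [x -> 0], the hyperplane section by [pform x] tends to the boundary [p_a = 0]. *)
Lemma degenerate_limit t N a (X : R -> 'M[C]_(k, n)) : incr a ->
  U [set x | Sol t N a (X x) /\ pform x (X x) = 0] ->
  exists (g : R -> seqs) (L : 'M[C]_(k, n)),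
    [/\ U [set x | \det (colsub (g x) (X x)) != 0],
        mtends U (fun x => normal_at (g x) (X x)) L, Sol t N a L & \det (colsub a L) = 0].
Proof.
move=> ia UX.
have gP x : exists g : seqs, incr g /\ (forall b, incr b -> `|minors (X x) b| <= `|minors (X x) g|).
  (* The norms are real but live in [C], whose order is partial; a maximum is taken over their real
     parts. *)
  case: (Order.TotalTheory.arg_maxP (P := @incr k n) (fun b => complex.Re `|minors (X x) b|) ia) => g ig gm.
  exists g; split => // b ib; have := gm b ib.
  by rewrite !normc_def lecR.
have {gP} [g gP] := choice gP.
have ig x : incr (g x) by case: (gP x).
have Ud : U [set x | \det (colsub (g x) (X x)) != 0].
  apply: filterS UX => x [[rX _ _] _] /=.
  have [b ib db] := rank_minor rX; have [_ /(_ b ib)] := gP x.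
  by rewrite -!normr_gt0; apply: lt_le_trans; rewrite normr_gt0.
pose Y x := normal_at (g x) (X x).
have UY : U [set x | Sol t N a (Y x) /\ pform x (Y x) = 0].
  apply: filterS2 UX Ud => x [sX fX] d; split; first exact: normal_at_Sol.
  by rewrite /pform lform_mulmx -/(pform x (X x)) fX mulr0.
have YL i j : exists l, tends U (fun x => Y x i j) l.
  apply: ultra_bounded_complex; apply: filterS Ud => x d /=.
  by have [_ gm] := gP x; apply: normal_at_le1.
have [l lP] := choice (fun ij : 'I_k * 'I_n => YL ij.1 ij.2).
pose L := \matrix_(i, j) l (i, j).
have YtL : mtends U Y L by move=> i j; rewrite mxE; exact: lP (i, j).
have t0 : tends U (fun=> 0 : C) 0 by exact: tends_cst.
exists g, L; split => //; first split.
(* [g x] varies with [x]; the vanishing of this product says that some minor equals 1, and this passes to the limit. *)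
- have : \prod_(b | incr b) (minors L b - 1) = 0.
    apply: (tends_eq_unique (f := fun x => \prod_(b | incr b) (minors (Y x) b - 1)) _ _ t0).
      apply: filterS Ud => x d /=; rewrite (bigD1 (g x)) //= /minors /Y normal_atE // det1.
      by rewrite subrr mul0r.
    apply: tends_prod => b; apply: tendsB; [exact: tends_minors|exact: tends_cst].
  move/eqP/prodf_eq0 => [b ib]; rewrite subr_eq0 => /eqP Lb.
  by apply: (@minor_rank _ _ _ _ b); rewrite -/(minors L b) Lb oner_eq0.
- move=> e ie ne; apply: (tends_eq_unique (f := fun x => minors (Y x) e) _ _ t0).
    by apply: filterS UY => x [[_ /(_ e ie ne) h _] _].
  exact: tends_minors.
- move=> m mN; apply: (tends_eq_unique (f := fun x => pform (t m) (Y x)) _ _ t0).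
    by apply: filterS UY => x [[_ _ h] _]; apply: h.
  apply: tends_lform => b; [exact: tends_cst|exact: tends_minors].
(* Multiplied by [x ^+ weight a], the equation [pform x = 0] has coefficients on the Schubert
   variety that extend continuously to 0, where only the term of [a] remains. *)
- have : cR (c a) * minors L a = 0.
    rewrite -(lform_wtS0 c (@cR R)) //.
    apply: (tends_eq_unique (f := fun x => lform (@cR R \o wtS c a x) (minors (Y x))) _ _ t0).
      apply: filterS2 UY U_gt0 => x [[_ sY _] fY] /= x0.
      by rewrite lform_wtS ?gt_eqF // -/(pform x (Y x)) fY mulr0.
    apply: tends_lform => b; last exact: tends_minors.
    apply: tends_cR; rewrite /wtS; case: ifP => _; last exact: tends_cst.
    apply: tendsM; [exact: tends_cst|apply: tendsX; exact: tends_id0].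
  by move/eqP; rewrite mulf_eq0 fmorph_eq0 (negbTE (c_neq0 ia)) => /eqP.
Qed.

(** Emptiness in negative expected dimension. *)
Definition no_small t N : Prop := forall a A, incr a -> (weight a < N)%N -> ~ Sol t N a A.

(** The plane lies in the cell of some [g <= b]; if [g] differed from [b], its weight would be below
    [N]. *)
Lemma Sol_cell t N b A : no_small t N -> incr b -> weight b = N -> Sol t N b A ->
  \det (colsub b A) != 0.
Proof.
move=> E ib wb sA; have [rA sbA fA] := sA.
have [g [ig dg sg]] := echelon rA.
have gb : bruhat_le g b by apply: contraNT dg => ngb; rewrite sbA.
have [<- //|ngb] := eqVneq g b.
case: (E g A) => //; rewrite -wb ltnNge; apply: contra ngb => w.
by rewrite (bruhat_weight_eq ig ib gb w).
Qed.

(** The cell containing [L] has an index [g <= a], and [p_a = 0] makes its weight smaller than that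
    of [a], hence at most [N]; [no_small] makes it at least [N]. For [weight a <= N] the conclusion
    is contradictory, which is how emptiness is propagated. *)
Lemma limit_Sol t N a L : no_small t N -> incr a -> (weight a <= N.+1)%N -> Sol t N a L ->
  \det (colsub a L) = 0 -> exists b, [/\ covers b a, weight b = N & Sol t N b L].
Proof.
move=> E ia wa [rL sL fL] da.
have [g [ig dg sg]] := echelon rL.
have ga : bruhat_le g a by apply: contraNT dg => nga; rewrite sL.
have lt : (weight g < weight a)%N.
  rewrite ltnNge; apply/negP => w; move: dg.
  by rewrite (bruhat_weight_eq ig ia ga w) da eqxx.
have sol : Sol t N g L by split.
have wg : weight g = N.
  apply/eqP; rewrite eqn_leq -ltnS (leq_trans lt wa) /= leqNgt; apply/negP => w.
  exact: (E g L).
exists g; split => //; apply: weight_covers => //; lia.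
Qed.

End Core.

(** * Deformation of a transverse solution *)

Section Branch.
Variable R : realType.
Variables k n : nat.
Local Notation seqs := {ffun 'I_k -> 'I_n}.
Local Notation C := R[i].
Variable c : seqs -> R.
Hypothesis c_neq0 : forall b : seqs, incr b -> c b != 0.
Variable U : set_system R.
Hypothesis UU : UltraFilter U.
Local Open Scope classical_set_scope.
Hypothesis UR : (0 : R)^'+ `<=` U.

Let UP : ProperFilter U. Proof. exact: ultra_proper. Qed.
Let UF : Filter U. Proof. exact: filter_filter. Qed.

Variables (t : nat -> R) (N : nat) (a b : seqs) (K0 : 'M[R]_(k, n)).
Hypotheses (ia : incr a) (ib : incr b) (cba : covers b a) (wb : weight b = N).
Hypotheses (K01 : colsub b K0 = 1%:M) (K0sol : Sol c t N b (cmx K0))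
  (K0tr : Transv c t N b (cmx K0)).

Let ba : bruhat_le b a. Proof. by case/and5P: cba. Qed.
Let iba : interlaced b a. Proof. by case: (covers_interlaced cba). Qed.
Let wa : weight a = N.+1. Proof. by case: (covers_interlaced cba) => _ ->; rewrite wb. Qed.
Let S := chart_pos b a.
Let cardS : #|S| = N.+1. Proof. by rewrite card_chart_pos. Qed.

(** The [N] old equations, then at index [N] the new one in rescaled form, so that the system makes
    sense at [x = 0]. Together they match the [N.+1] chart coordinates. *)
Let Wr (x : R) (l : nat) : seqs -> R := if (l < N)%N then wt c (t l) else wtS c a x.
Let Wc (x : R) (l : nat) : seqs -> C := @cR R \o Wr x l.

Let colsub_cR (g : seqs) (A : 'M[R]_(k, n)) : colsub g (cmx A) = cmx (colsub g A).
Proof. by apply/matrixP => i j; rewrite !mxE. Qed.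

Let K0C1 : colsub b (cmx K0) = 1%:M.
Proof. by rewrite colsub_cR K01 /cmx map_mx1. Qed.

Let K0low : lowtri b (cmx K0).
Proof. by case: K0sol => _ sK _; apply: (chart_lowtri ib ib (interlaced_refl ib)). Qed.

Let lowtri_ba (V : 'M[C]_(k, n)) : lowtri b V -> lowtri a V.
Proof. by move=> lV i d id_; apply: lV; apply: leq_ltn_trans id_; apply: (bruhatP _ _ ba). Qed.

(* The chart has one coordinate more than the cell of [b]; the last equation, [p_a], kills it. *)
Let J0unit : jac S (Wc 0) (cmx K0) (cmx K0) \in unitmx.
Proof.
apply: jac_unit => v Hv.
have [V0 lV] := emb_chart v; set V := emb v in V0 lV *.
have Vb : lowtri b V.
  move=> i d bd; have [ad|da] := ltnP (a i) d; first exact: lV.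
  have [/codomP[j ->]|nd] := boolP (d \in codom b).
    by move/matrixP/(_ i j): V0; rewrite !mxE.
  have [e ie [s sE]] := sort_inj (exchange_inj (i := i) ib nd).
  (* For [b i < d <= a i] the exchanged sequence stays below [a] and has a larger weight than [b],
     so it is [a]; the last equation then says that the entry [V i d] vanishes. *)
  have ea : e = a.
    have le_ea : bruhat_le e a.
      apply: (perm_dominated (s := (s^-1)%g)) => // j; rewrite sE permKV /exchange.
      by case: eqP => [->|_]; [|exact: (bruhatP _ _ ba)].
    apply: (bruhat_weight_eq ie ia le_ea); rewrite wa -wb.
    have sb : (\sum_(j < k) b j = b i + \sum_(j < k | j != i) b j)%N by rewrite (bigD1 i).
    have sx : (\sum_(j < k) e j = d + \sum_(j < k | j != i) b j)%N.
      rewrite (eq_bigr (fun x => exchange b i d (s x) : nat)); last by move=> x _; rewrite sE.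
      rewrite -(reindex_inj (h := s) (F := fun x => exchange b i d x : nat) (P := xpredT)) //=; last exact: perm_inj.
      rewrite /exchange (bigD1 i) //= eqxx; congr addn.
      by apply: eq_bigr => x /negbTE->.
    have := weight_sum ie; have := weight_sum ib; rewrite sb sx.
    move: (\sum_(j < k | _) b j)%N (\sum_(j < k) j)%N => y z; lia.
  have := Hv (Ordinal (eq_leq (esym cardS))) => /=.
  rewrite /Wc /Wr ltnn lform_wtS0 // => /eqP.
  rewrite mulf_eq0 fmorph_eq0 (negbTE (c_neq0 ia)) /= -ea /quots => /eqP.
  rewrite (minor_quot_perm _ _ _ sE) (minor_quot_exchange K0C1 V0 (g := exchange b i d) (fun j => erefl)).
  by move/eqP; rewrite mulf_eq0 signr_eq0 /= => /eqP.
(* Now [V] is tangent to the Schubert variety of [b], so transversality of [K0] makes it vertical;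
   its columns [b] being zero, it vanishes. *)
have [|l lN|M VM] := K0tr (V := V).
- by move=> e ie ne; apply: (minor_quot_lowtri ib ie).
- have lS : (l < #|S|)%N by rewrite cardS ltnS ltnW.
  by have := Hv (Ordinal lS); rewrite /Wc /Wr /= lN.
have M0 : M = 0.
  by move: V0; rewrite VM colsub_mulmx K0C1 mulmx1.
by apply: emb_inj0; rewrite -/V VM M0 mul0mx.
Qed.

Definition chart_sol (x : R) (A : 'M[C]_(k, n)) : Prop :=
  [/\ colsub b A = 1%:M, lowtri a A, forall l, (l < N)%N -> pform c (t l) A = 0 & pform c x A = 0].

Let chart_sol_lform x A : x != 0 -> chart_sol x A -> forall l, lform (Wc x l) (minors A) = 0.
Proof.
move=> x0 [A1 lA fA fx] l; rewrite /Wc /Wr; case: ifP => [lN|_]; first exact: fA.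
rewrite lform_wtS //; first by rewrite -/(pform c x A) fx mulr0.
exact: (lowtri_schub ia lA).
Qed.

Let tends_Wr l e : tends U (fun x => Wr x l e) (Wr 0 l e).
Proof.
rewrite /Wr; case: ifP => _; first exact: tends_cst.
rewrite /wtS; case: ifP => _; last exact: tends_cst.
by apply: tendsM; [exact: tends_cst|apply: tendsX; exact: tends_id0].
Qed.

Let jac_near (A A' : R -> 'M[C]_(k, n)) : mtends U A (cmx K0) -> mtends U A' (cmx K0) ->
  U [set x | jac S (Wc x) (A x) (A' x) \in unitmx].
Proof.
move=> hA hA'; have J0 := J0unit; rewrite unitmxE unitfE in J0.
have JJ : mtends U (fun x => jac S (Wc x) (A x) (A' x)) (jac S (Wc 0) (cmx K0) (cmx K0)).
  by apply: mtends_jac => // l e; apply: tends_cR; apply: tends_Wr.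
by apply: filterS (tends_ne0 (tends_det JJ) J0) => x /=; rewrite unitmxE unitfE.
Qed.

(** In the chart the difference [A x - A' x] is a vector [v] killed by the matrix of difference
    quotients between the two points, an exact identity that needs no estimate of the remainder. *)
Lemma chart_sol_unique (A A' : R -> 'M[C]_(k, n)) :
  mtends U A (cmx K0) -> mtends U A' (cmx K0) ->
  U [set x | chart_sol x (A x)] -> U [set x | chart_sol x (A' x)] -> U [set x | A x = A' x].
Proof.
move=> hA hA' sA sA'; have sAA := @filterI _ U UF _ _ sA sA'.
have u0 : U [set x | 0 < x] := U_gt0 UR.
have sJ := @filterI _ U UF _ _ (@filterI _ U UF _ _ sAA u0) (jac_near hA hA').
apply: filterS sJ => x /= [[[s1 s2] x0] Ju].
have [A1 lA _ _] := s1; have [A1' lA' _ _] := s2.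
have [|i d id_|v vE] := @chart_emb _ _ _ b a (A x - A' x).
- by apply/matrixP => i j; move/matrixP/(_ i j): A1; move/matrixP/(_ i j): A1'; rewrite !mxE => -> ->; rewrite subrr.
- by rewrite !mxE lA // lA' // subr0.
have v0 : v = 0.
  apply: (jac_unitP Ju) => l; rewrite -vE -lform_diff.
  by rewrite !chart_sol_lform ?gt_eqF // subrr.
by apply/eqP; rewrite -subr_eq0 vE v0 /emb big1 // => i _; rewrite mxE scale0r.
Qed.

Lemma chart_sol_transv (A : R -> 'M[C]_(k, n)) : mtends U A (cmx K0) ->
  U [set x | chart_sol x (A x)] ->
  U [set x | forall V, (forall e, incr e -> ~~ bruhat_le e a -> minor_quot e (A x) (A x) V = 0) ->
    (forall l, (l < N)%N -> dpform c (t l) (A x) V = 0) -> dpform c x (A x) V = 0 ->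
    exists M, V = M *m A x].
Proof.
move=> hA sA; have u0 : U [set x | 0 < x] := U_gt0 UR.
have sJ := @filterI _ U UF _ _ (@filterI _ U UF _ _ sA u0) (jac_near hA hA).
apply: filterS sJ => x /= [[s1 x0] Ju] V dV fV fxV.
have [A1 lA fA fx] := s1.
(* Subtracting a vertical direction makes the columns [b] zero; the remaining vector is tangent to
   the chart and is killed by the Jacobian matrix. *)
pose M := colsub b V; pose V' := V - M *m A x.
have V'0 : colsub b V' = 0.
  have -> : colsub b V' = colsub b V - M *m colsub b (A x).
    by rewrite -colsub_mulmx; apply/matrixP => i j; rewrite !mxE.
  by rewrite A1 mulmx1 subrr.
have dV' e : incr e -> ~~ bruhat_le e a -> minor_quot e (A x) (A x) V' = 0.
  move=> ie ne; rewrite /V' -scaleN1r addrC minor_quot_linear dV // addr0.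
  by rewrite minor_quot_vertical (lowtri_schub ia lA) // !mulr0.
have lV' := chart_lowtri_tangent ib ia iba A1 V'0 dV'.
have [v vE] := chart_emb V'0 lV'.
suff v0 : v = 0.
  exists M; apply/eqP; rewrite -subr_eq0 -/V' vE v0 /emb big1 // => i _.
  by rewrite mxE scale0r.
apply: (jac_unitP Ju) => l; rewrite -vE /Wc /Wr.
have vert y : pform c y (A x) = 0 -> dpform c y (A x) V = 0 -> dpform c y (A x) V' = 0.
  by move=> fy dy; rewrite /dpform lform_quotsB lform_vertical -/(pform c y (A x)) fy mulr0 -/(dpform c y (A x) V) dy subr0.
case: ifP => [lN|_]; first by apply: vert; [exact: fA|exact: fV].
rewrite lform_wtS ?gt_eqF //.
by rewrite -/(dpform c x (A x) V') vert // mulr0.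
Qed.

(** The coefficients and the starting point are real, so Newton's iteration runs in real chart
    coordinates. *)
Lemma branch : exists Y : R -> 'M[R]_(k, n),
  mtends U (fun x => cmx (Y x)) (cmx K0) /\ U [set x | chart_sol x (cmx (Y x))].
Proof.
pose X (z : 'rV[R]_#|S|) := K0 + emb z.
pose G (x : R) (z : 'rV[R]_#|S|) : 'rV[R]_#|S| := \row_(l < #|S|) lform (Wr x l) (minors (X z)).
pose J (x : R) z z' := jac S (Wr x) (X z) (X z').
have GJ x z z' : G x z - G x z' = (z - z') *m J x z z'.
  rewrite jac_mul; apply/rowP => l; rewrite !mxE lform_diff.
  by congr (lform _ (quots _ _ _)); rewrite -embB /X opprD addrACA subrr add0r.
have X0 : X 0 = K0.
  by rewrite /X /emb big1 ?addr0 // => i _; rewrite mxE scale0r.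
have J0u : jac S (Wr 0) K0 K0 \in unitmx.
  have := J0unit; rewrite /cmx (jac_map (@cR R) S (Wr 0) K0 K0) map_unitmx; exact.
have ZF : Filter (zero_right_filter (0 : 'rV[R]_#|S|)) by apply: filter_prod_filter.
have XK0 (T : Type) (F : set_system T) (FF : Filter F) (f : T -> 'rV[R]_#|S|) :
    mtends F f 0 -> mtends F (fun y => X (f y)) K0.
  move=> hf i j; rewrite -X0 !mxE; under eq_fun do rewrite !mxE.
  apply: tendsD; first exact: tends_cst.
  rewrite /emb !summxE; under eq_fun do rewrite summxE.
  apply: tends_sum => q; rewrite mxE; under eq_fun do rewrite mxE.
  by apply: tendsM; last exact: tends_cst.
have cvg_mtends (f : ('rV[R]_#|S| * 'rV[R]_#|S|) * R -> 'rV[R]_#|S|) :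
    f @ zero_right_filter (0 : 'rV[R]_#|S|) --> (0 : 'rV[R]_#|S|) ->
    mtends (zero_right_filter (0 : 'rV[R]_#|S|)) f 0.
  move=> hf i j; have cc := @coord_continuous R 1 #|S| i j (0 : 'rV[R]_#|S|).
  exact: (cvg_comp _ _ hf cc).
have a_nle_b : ~~ bruhat_le a b.
  by apply/negP => /weight_le; rewrite wa wb ltnn.
(* The last limit equation is [p_a], which vanishes at [K0] because [a] is not below [b]. *)
have K0zero l : lform (Wr 0 l) (minors K0) = 0.
  apply/eqP; rewrite -(fmorph_eq0 (@cR R)) -lform_minors_map -/(cmx K0); apply/eqP.
  case: K0sol => _ sK fK; rewrite /Wr; case: ifP => [lN|_]; first exact: fK.
  by rewrite lform_wtS0 // /minors sK // mulr0.
have [||z [Uz zt]] := @newton_path R U #|S| 0 G J (jac S (Wr 0) K0 K0) UF UR GJ J0u.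
  apply: mtends_jac.
  - move=> l e; rewrite /Wr; case: ifP => _; first exact: tends_cst.
    rewrite /wtS; case: ifP => _; last exact: tends_cst.
    apply: tendsM; first exact: tends_cst.
    apply: tendsX; apply: (@cvg_trans _ ((fun y : R => y) @ (0 : R)^'+)).
      exact: (cvg_comp _ _ cvg_snd cvg_id).
    exact: cvg_within.
  - by apply: XK0; apply: cvg_mtends; exact: (cvg_comp _ _ cvg_fst cvg_fst).
  - by apply: XK0; apply: cvg_mtends; exact: (cvg_comp _ _ cvg_fst cvg_snd).
  move=> i l; rewrite mxE -(K0zero l) -X0; under eq_fun do rewrite mxE.
  apply: tends_lform => e; [exact: tends_Wr|exact: tends_cst].
exists (fun x => X (z x)); split.
  by move=> i j; rewrite mxE; under eq_fun do rewrite mxE; apply: tends_cR; apply: XK0.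
have u0 : U [set x | 0 < x] := U_gt0 UR.
apply: filterS (@filterI _ U UF _ _ Uz u0) => x [/= Gz x0].
have XE : cmx (X (z x)) = cmx K0 + cmx (emb (z x)).
  by apply/matrixP => i j; rewrite !mxE rmorphD.
have [e0 le] := emb_chart (z x).
have X1 : colsub b (cmx (X (z x))) = 1%:M.
  rewrite XE; apply/matrixP => i j; move/matrixP/(_ i j): K0C1; move/matrixP/(_ i j): e0.
  by rewrite !mxE => -> ->; rewrite rmorph0 addr0.
have Xl : lowtri a (cmx (X (z x))).
  by move=> i d id_; rewrite XE mxE (lowtri_ba K0low) // mxE le // rmorph0 addr0.
have eqs (l : nat) : (l < N.+1)%N -> lform (Wr x l) (minors (X (z x))) = 0.
  by rewrite -cardS => lS; move/rowP/(_ (Ordinal lS)): Gz; rewrite !mxE.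
split => // [l lN|].
  have := eqs l (ltnW lN); rewrite /Wr lN => e; by rewrite /pform lform_minors_map e rmorph0.
have : lform (@cR R \o wtS c a x) (minors (cmx (X (z x)))) = 0.
  by have := eqs N (ltnSn N); rewrite /Wr ltnn lform_minors_map => ->; rewrite rmorph0.
rewrite lform_wtS ?gt_eqF //; last exact: (lowtri_schub ia Xl).
move/eqP; rewrite mulf_eq0 fmorph_eq0 expf_eq0 gt_eqF // andbF /= => /eqP; exact.
Qed.

End Branch.

(** * Saturated chains *)

Section Chains.
Variables k n : nat.
Local Notation T := {ffun 'I_k -> 'I_n}.
Implicit Types a b : T.

Definition chains (m : nat) a : {set {ffun 'I_m.+1 -> T}} :=
  [set c : {ffun 'I_m.+1 -> T} | [&& is_bot (c ord0), c ord_max == a &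
     [forall i : 'I_m, covers (c (widen_ord (leqnSn m) i)) (c (lift ord0 i))]]].

Lemma is_bot_weight a : incr a -> is_bot a = (weight a == 0%N).
Proof.
move=> ia; apply/forallP/eqP => [H|w j].
  by rewrite /weight big1 // => j _; rewrite (eqP (H j)) subnn.
move/eqP: w; rewrite sum_nat_eq0 => /forallP/(_ j) /=; rewrite subn_eq0 => h.
by rewrite eqn_leq h incr_ge.
Qed.

Lemma is_bot_incr a : is_bot a -> incr a.
Proof. by move=> /forallP H; apply/incrP => i j; rewrite (eqP (H i)) (eqP (H j)). Qed.

(** Every cover raises the weight by one, starting from 0; a single length therefore contributes to
    [nchains]. *)
Lemma chains_weight m a (c : {ffun 'I_m.+1 -> T}) : c \in chains m a -> weight a = m.
Proof.
rewrite inE => /and3P[c0 /eqP cm /forallP cc].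
suff H (i : nat) (im : (i < m.+1)%N) : weight (c (Ordinal im)) = i.
  by rewrite -cm (_ : ord_max = Ordinal (ltnSn m)) ?H //; apply: val_inj.
elim: i im => [|i IH] im.
  have -> : Ordinal im = ord0 by apply: val_inj.
  by apply/eqP; rewrite -is_bot_weight // is_bot_incr.
have im' : (i < m)%N by [].
have := cc (Ordinal im'); case/covers_interlaced => _.
have -> : lift ord0 (Ordinal im') = Ordinal im by apply: val_inj.
move=> ->; rewrite -[in RHS](IH (ltnW im)); congr (weight (c _)).+1; exact: val_inj.
Qed.

Lemma chains0 a : #|chains 0 a| = is_bot a.
Proof.
case ba: (is_bot a); last first.
  apply: eq_card0 => c; rewrite !inE; apply/negP => /and3P[c0 /eqP cm _]; move: ba.
  by rewrite -cm (_ : ord_max = ord0) ?c0 //; apply: val_inj.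
apply/eqP/cards1P; exists [ffun=> a]; apply/setP => c; rewrite !inE.
apply/and3P/eqP => [[_ /eqP ca _]|->].
  by apply/ffunP => i; rewrite ffunE -ca; congr (c _); apply: val_inj; case: i => [[]].
by rewrite !ffunE ba eqxx; split => //; apply/forallP => -[].
Qed.

(** The last element but one of a chain is a sequence covered by [a]; [ext] appends [a] to a chain
    that ends there. *)
Lemma chainsS m a : #|chains m.+1 a| = (\sum_(b | covers b a) #|chains m b|)%N.
Proof.
rewrite -sum1_card (partition_big (fun c : {ffun 'I_m.+2 -> T} => c (widen_ord (leqnSn m.+1) ord_max)) (fun b => covers b a)) /=; last first.
  move=> c; rewrite inE => /and3P[_ /eqP <- /forallP/(_ ord_max)].
  by rewrite (_ : lift ord0 ord_max = ord_max) //; apply: val_inj.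
apply: eq_bigr => b ba; rewrite sum1_card.
pose ext (c : {ffun 'I_m.+1 -> T}) : {ffun 'I_m.+2 -> T} :=
  [ffun i => if unlift ord_max i is Some j then c j else a].
have extl c j : ext c (lift ord_max j) = c j by rewrite ffunE liftK.
have extm c : ext c ord_max = a by rewrite ffunE unlift_none.
have ext_inj : injective ext.
  by move=> c c' /ffunP E; apply/ffunP => j; rewrite -!extl E.
have wl (j : 'I_m.+1) : widen_ord (leqnSn m.+1) j = lift ord_max j.
  by apply: val_inj; rewrite /= /bump leqNgt ltn_ord.
have l0 (i : 'I_m) : lift ord0 (widen_ord (leqnSn m) i) = lift ord_max (lift ord0 i) :> 'I_m.+2.
  by apply: val_inj; rewrite /= /bump /= !add1n ltnNge ltn_ord.
rewrite -(card_imset _ ext_inj); apply: eq_card => c; rewrite [LHS]inE [in LHS]inE.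
apply/andP/imsetP => [[/and3P[c0 /eqP ca /forallP cc] /eqP cb]|[c' + ->]].
  exists [ffun j => c (lift ord_max j)].
    rewrite inE; apply/and3P; split; rewrite ?ffunE -?wl ?cb //.
      by rewrite (_ : widen_ord _ _ = ord0) //; apply: val_inj.
    by apply/forallP => i; rewrite !ffunE -l0 -wl; apply: cc.
  apply/ffunP => i; rewrite ffunE; case: unliftP => [j ->|->] //; by rewrite ffunE.
rewrite inE => /and3P[c0 /eqP cb /forallP cc]; rewrite extm wl extl cb !eqxx; split => //.
apply/and3P; split => //.
  by rewrite (_ : ord0 = lift ord_max ord0) ?extl //; apply: val_inj.
apply/forallP => i; rewrite wl extl; have [im|mi] := ltnP i m.
  have -> : i = widen_ord (leqnSn m) (Ordinal im) by apply: val_inj.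
  by rewrite l0 extl.
have im : i = ord_max by apply: val_inj; apply/eqP; rewrite eqn_leq mi -ltnS ltn_ord.
rewrite im (_ : lift ord0 ord_max = ord_max); last exact: val_inj.
by rewrite extm cb.
Qed.

(** Guarantees that the length [weight a] occurs in the bounded sum that defines [nchains]. *)
Lemma weight_card a : (weight a < #|T|)%N.
Proof.
rewrite card_ffun !card_ord.
have [n0|n0] := posnP n.
  have [k0|k0] := posnP k; last by case: (a (Ordinal k0)) => q; lia.
  have -> : weight a = 0%N by rewrite /weight big1 // => -[j]; lia.
  by rewrite expn_gt0 k0 orbT.
have wle : (weight a <= k * n.-1)%N.
  rewrite -[X in (_ <= X * _)%N](card_ord k) -sum_nat_const; apply: leq_sum => j _.
  by rewrite (leq_trans (leq_subr _ _)) // -ltnS prednK // ltn_ord.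
apply: leq_ltn_trans wle _; elim: k => [|q IH]; first by rewrite expn0.
rewrite expnS; case: n n0 IH => // p _ /= IH.
rewrite mulSn [X in (_ < X)%N]mulSn; nia.
Qed.

Lemma nchainsE a : nchains a = #|chains (weight a) a|.
Proof.
rewrite /nchains (bigD1 (Ordinal (weight_card a))) //= big1 ?addn0 // => m nm.
apply: eq_card0 => c; apply/negP => /chains_weight w; case/eqP: nm.
by apply: val_inj; rewrite /= w.
Qed.

Lemma nchains_bot a : incr a -> weight a = 0%N -> nchains a = 1%N.
Proof. by move=> ia w; rewrite nchainsE w chains0 is_bot_weight // w eqxx. Qed.

Lemma nchains_covers a N : weight a = N.+1 -> nchains a = (\sum_(b | covers b a) nchains b)%N.
Proof.
move=> w; rewrite nchainsE w chainsS; apply: eq_bigr => b ba.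
by rewrite nchainsE; have [_] := covers_interlaced ba; rewrite w => -[->].
Qed.

End Chains.

(** * Inductive choice of the parameters *)

Section Induction.
Variable R : realType.
Variables k n : nat.
Local Notation seqs := {ffun 'I_k -> 'I_n}.
Local Notation C := R[i].
Variable c : seqs -> R.
Hypothesis c_neq0 : forall b : seqs, incr b -> c b != 0.
Implicit Types (a b e : seqs) (A V : 'M[C]_(k, n)) (t : nat -> R) (N : nat).

Definition real_points t N a : Prop := exists s : seq 'M[R]_(k, n),
  [/\ size s = nchains a, uniq s, forall K, K \in s -> Sol c t N a (cmx K),
      {in s &, forall K K', (cmx K == cmx K')%MS -> K = K'} &
      forall A, Sol c t N a A -> exists2 K, K \in s & (A == cmx K)%MS].

(** Counting and transversality are recorded only for weight exactly [N]. They persist when later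
    parameters are added, since they involve only the first [N] of them. *)
Definition generic t N : Prop :=
  [/\ no_small c t N, forall l, (l < N)%N -> 0 < t l &
      forall a, incr a -> weight a = N ->
        real_points t N a /\ forall A, Sol c t N a A -> Transv c t N a A].

Definition upd t N (x : R) (l : nat) : R := if (l < N)%N then t l else x.

Lemma Sol_upd t N x a A : Sol c (upd t N x) N.+1 a A <-> Sol c t N a A /\ pform c x A = 0.
Proof.
split=> [[rA sA fA]|[[rA sA fA] fx]].
  split; last by have := fA N (ltnSn N); rewrite /upd ltnn.
  by split => // l lN; have := fA l (ltnW lN); rewrite /upd lN.
split => // l; rewrite ltnS leq_eqVlt => /orP[/eqP ->|lN]; rewrite /upd ?ltnn // lN.
exact: fA.
Qed.

Section Step.
Variable U : set_system R.
Hypothesis UU : UltraFilter U.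
Local Open Scope classical_set_scope.
Hypothesis UR : (0 : R)^'+ `<=` U.
Variables (t : nat -> R) (N : nat).
Hypothesis tN : generic t N.

Let UP : ProperFilter U. Proof. exact: ultra_proper. Qed.
Let UF : Filter U. Proof. exact: filter_filter. Qed.
Let small : no_small c t N. Proof. by case: tN. Qed.
Let UI (P Q : set R) : U P -> U Q -> U (P `&` Q). Proof. exact: filterI. Qed.

(** If the set is not in [U], its complement is, and counterexamples can be chosen there; they form
    the family [X]. The element [i0] is the value of [X] elsewhere. *)
Lemma ultra_forall (I : Type) (P : R -> I -> Prop) (i0 : I) :
  (forall X : R -> I, U [set x | ~ P x (X x)] -> False) -> U [set x | forall i, P x i].
Proof.
move=> H; have [//|nP] := in_ultra_setVsetC [set x | forall i, P x i] UU.
have ex x : exists i, ~ (forall i, P x i) -> ~ P x i.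
  have [h|] := pselect (forall i, P x i); first by exists i0.
  by move/existsNP => [i Pi]; exists i.
have [X hX] := choice ex.
by case: (H X); apply: filterS nP => x /= /hX.
Qed.

Lemma filter_seq (I : eqType) (s : seq I) (P : I -> set R) :
  (forall i, i \in s -> U (P i)) -> U [set x | forall i, i \in s -> P i x].
Proof.
elim: s => [|i s IH] H; first by apply: filterS filterT => x _ i; rewrite in_nil.
have h1 := H i (mem_head i s).
have h2 : U [set x | forall j, j \in s -> P j x] by apply: IH => j js; apply: H; rewrite inE js orbT.
apply: filterS (UI h1 h2) => x /= [p q] j.
by rewrite inE => /orP[/eqP -> //|]; apply: q.
Qed.

(** A family of solutions would degenerate to a solution for some [b] of weight [N] covered by [a],
    which requires [weight a = N.+1]. *)
Lemma near_no_small : U [set x | no_small c (upd t N x) N.+1].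
Proof.
have H a : U [set x | incr a -> (weight a < N.+1)%N -> forall A, ~ Sol c (upd t N x) N.+1 a A].
  have [ia|] := boolP (incr a); last by move=> _; apply: filterS filterT => x _.
  have [wa|] := boolP (weight a < N.+1)%N; last by move=> _; apply: filterS filterT => x _.
  suff : U [set x | forall A, ~ Sol c (upd t N x) N.+1 a A] by apply: filterS => x h _ _.
  apply: (@ultra_forall _ _ 0) => X UX.
  have UX' : U [set x | Sol c t N a (X x) /\ pform c x (X x) = 0].
    by apply: filterS UX => x /= /contrapT /Sol_upd.
  have [g [L [_ _ sL dL]]] := degenerate_limit c_neq0 UU UR ia UX'.
  have [b [ba wb _]] := limit_Sol small ia (leqW (ltnSE wa)) sL dL.
  have [_] := covers_interlaced ba; lia.
apply: filterS (filter_forall UF H) => x h a A ia wa; exact: h.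
Qed.

Section OneSequence.
Variable a : seqs.
Hypotheses (ia : incr a) (wa : weight a = N.+1).

Let covered b : covers b a -> [/\ incr b, incr a, bruhat_le b a & weight b = N].
Proof.
move=> ba; have [_] := covers_interlaced ba; rewrite wa => -[wb].
by case/and5P: ba.
Qed.

Lemma chart_sol_Sol b x A : chart_sol c t N a b x A -> Sol c (upd t N x) N.+1 a A.
Proof.
move=> [A1 lA fA fx]; apply/Sol_upd; split => //; split => //.
  by apply: (@minor_rank _ _ _ _ b); rewrite A1 det1 oner_eq0.
exact: lowtri_schub.
Qed.

(** For [U]-almost all [x] the branches are solutions, span distinct planes, exhaust the complex
    solutions and are transverse; each fact holds on its own set of [U]. *)
Lemma near_real_points : U [set x | real_points (upd t N x) N.+1 a /\
  forall A, Sol c (upd t N x) N.+1 a A -> Transv c (upd t N x) N.+1 a A].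
Proof.
case: tN => _ _ HN.
pose good b (s : seq 'M[R]_(k, n)) := [/\ size s = nchains b, uniq s,
    forall K, K \in s -> Sol c t N b (cmx K),
    {in s &, forall K K', (cmx K == cmx K')%MS -> K = K'} &
    forall A, Sol c t N b A -> exists2 K, K \in s & (A == cmx K)%MS].
have [sl slP] : exists sl, forall b, covers b a -> good b (sl b).
  have ex b : exists s, covers b a -> good b s.
    have [ba|_] := boolP (covers b a); last by exists [::].
    by have [ib _ _ wb] := covered ba; have [[s hs] _] := HN b ib wb; exists s.
  by have [sl h] := choice ex; exists sl.
(* One branch starts from each solution of each covered [b]; the length of this list is the
   recursion for [nchains]. *)
pose L := [seq (b, K) | b <- enum (fun b => covers b a), K <- sl b].
have LP b K : (b, K) \in L <-> covers b a /\ K \in sl b.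
  split=> [/allpairsPdep[b' [K' [+ h []]]]|[ba Ks]].
    by rewrite mem_enum => h' -> ->.
  by apply/allpairsPdep; exists b, K; split => //; rewrite mem_enum.
have sizeL : size L = nchains a.
  rewrite (nchains_covers wa) size_allpairs_dep sumnE big_map big_enum_cond /=.
  by apply: eq_big => [b|b ba]; [rewrite andbT|move: ba; rewrite andbT => /slP[]].
have uL : uniq L.
  apply: allpairs_uniq_dep => [|b|]; first exact: enum_uniq.
    by rewrite mem_enum => ba; have [] := slP b ba.
  by move=> [b K] [b' K'] _ _ [-> ->].
have solL b K : (b, K) \in L -> [/\ covers b a, incr b, weight b = N, Sol c t N b (cmx K)
    & \det (colsub b (cmx K)) != 0].
  move=> /LP[ba Ks]; have [ib _ _ wb] := covered ba; have [_ _ sK _ _] := slP b ba.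
  have s := sK K Ks; split => //; exact: (Sol_cell small ib wb s).
(* By [Sol_cell] the minor [b] is nonzero at each starting point, which can thus be normalized into
   the chart of [b]. *)
pose Kn (p : seqs * 'M[R]_(k, n)) := normal_at p.1 p.2.
have cmxKn p : cmx (Kn p) = normal_at p.1 (cmx p.2).
  rewrite /Kn /normal_at /cmx map_mxM map_invmx; congr (invmx _ *m _).
  by apply/matrixP => i j; rewrite !mxE.
have Kn1 p : p \in L -> colsub p.1 (cmx (Kn p)) = 1%:M.
  case: p => b K /solL[_ _ _ _ d]; rewrite cmxKn; exact: normal_atE.
have Kn1R p : p \in L -> colsub p.1 (Kn p) = 1%:M.
  move=> pL; apply: (map_mx_inj (f := @cR R)); rewrite map_mx1 -(Kn1 p pL).
  by apply/matrixP => i j; rewrite !mxE.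
have KnSol p : p \in L -> Sol c t N p.1 (cmx (Kn p)).
  case: p => b K /solL[_ _ _ s d]; rewrite cmxKn; exact: normal_at_Sol.
have KnT p : p \in L -> Transv c t N p.1 (cmx (Kn p)).
  move=> pL; have sK := KnSol p pL; case: p pL sK => b K /solL[_ ib wb _ _].
  by have [_] := HN b ib wb; apply.
have KnE p : p \in L -> (cmx (Kn p) == cmx p.2)%MS.
  case: p => b K /solL[_ _ _ s d]; rewrite cmxKn; exact: normal_at_eq.
have [Y YP] : exists Y : seqs * 'M[R]_(k, n) -> R -> 'M[R]_(k, n), forall p, p \in L ->
    mtends U (fun x => cmx (Y p x)) (cmx (Kn p)) /\
    U [set x | chart_sol c t N a p.1 x (cmx (Y p x))].
  have ex p : exists y : R -> 'M[R]_(k, n), p \in L ->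
      mtends U (fun x => cmx (y x)) (cmx (Kn p)) /\
      U [set x | chart_sol c t N a p.1 x (cmx (y x))].
    have [pL|_] := boolP (p \in L); last by exists (fun=> 0).
    have [ba ib wb _ _] : [/\ covers p.1 a, incr p.1, weight p.1 = N, Sol c t N p.1 (cmx p.2)
      & \det (colsub p.1 (cmx p.2)) != 0] by apply: solL; rewrite -surjective_pairing.
    by have [y yP] := branch c_neq0 UU UR ia ib ba wb (Kn1R p pL) (KnSol p pL) (KnT p pL); exists y.
  by have [Y h] := choice ex; exists Y.
have Usol : U [set x | forall p, p \in L -> Sol c (upd t N x) N.+1 a (cmx (Y p x))].
  apply: filter_seq => p pL; have [_ h] := YP p pL; apply: filterS h => x; exact: chart_sol_Sol.
have Uinj : U [set x | forall p, p \in L -> forall q, q \in L -> (cmx (Y p x) == cmx (Y q x))%MS -> p = q].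
  apply: filter_seq => p pL; apply: filter_seq => q qL.
  have [->|npq] := eqVneq p q; first by apply: filterS filterT => x _.
  have [//|Ueq] := in_ultra_setVsetC [set x | (cmx (Y p x) == cmx (Y q x))%MS -> p = q] UU.
  have [hp sp] := YP p pL; have [hq sq] := YP q qL.
  (* If two branches span the same plane for [U]-almost all [x], so do their limits. *)
  have KE : cmx (Kn p) = colsub q.1 (cmx (Kn p)) *m cmx (Kn q).
    apply/matrixP => i j.
    apply: (tends_unique (hp i j)).
    have hM : mtends U (fun x => colsub q.1 (cmx (Y p x)) *m cmx (Y q x))
        (colsub q.1 (cmx (Kn p)) *m cmx (Kn q)).
      by apply: mtends_mul => //; apply: mtends_sub.
    apply: (tends_eq _ (hM i j)); apply: filterS (UI Ueq sq) => x /= [/not_implyP[/andP[/submxP[M YE] _] _] [Y1 _ _ _]].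
    by rewrite {1}YE colsub_mulmx Y1 mulmx1 -YE.
  have rp : \rank (cmx (Kn p)) = k by case: (KnSol p pL).
  have rq : \rank (cmx (Kn q)) = k by case: (KnSol q qL).
  have sub : (cmx (Kn p) <= cmx (Kn q))%MS by apply/submxP; exists (colsub q.1 (cmx (Kn p))).
  have Kpq : (cmx (Kn p) == cmx (Kn q))%MS by rewrite -mxrank_leqif_eq // rp rq.
  have E2 : (cmx p.2 == cmx q.2)%MS.
    apply/eqmxP; apply: eqmx_trans (eqmx_sym (eqmxP (KnE p pL))) _.
    exact: eqmx_trans (eqmxP Kpq) (eqmxP (KnE q qL)).
  case: p q pL qL npq E2 {hp sp hq sq KE rp rq sub Kpq Ueq} => [b K] [b' K'] pL qL npq E2.
  have [ba ib wb sK dK] := solL b K pL; have [ba' ib' wb' sK' dK'] := solL b' K' qL.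
  (* The common plane has [p_b <> 0] and lies in the Schubert variety of [b'], so [b <= b'], and the
     weights agree. *)
  have bb : b = b'.
    apply: (bruhat_weight_eq ib ib'); last by rewrite wb wb'.
    have [_ sb _] := Sol_eqmx (etrans (andbC _ _) E2) sK'.
    by apply: contraNT dK => nle; rewrite sb.
  subst b'; have [_ Ks] := (LP b K).1 pL; have [_ Ks'] := (LP b K').1 qL.
  have [_ _ _ inj _] := slP b ba.
  by case/eqP: npq; rewrite (inj K K' Ks Ks' E2).
have Ucomp : U [set x | forall A, Sol c (upd t N x) N.+1 a A -> exists2 p, p \in L & (A == cmx (Y p x))%MS].
  apply: (@ultra_forall _ _ 0) => X UX.
  have UX' : U [set x | Sol c t N a (X x) /\ pform c x (X x) = 0].
    by apply: filterS UX => x /= /not_implyP[/Sol_upd].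
  have [g [Z [Ud gZ sZ dZ]]] := degenerate_limit c_neq0 UU UR ia UX'.
  have [b [ba wb sbZ]] := limit_Sol small ia (eq_leq wa) sZ dZ.
  have [_ _ _ _ /(_ Z sbZ)[K Ks ZK]] := slP b ba.
  have pL : (b, K) \in L by apply/LP.
  have [_ ib _ _ dK] := solL b K pL.
  have dbZ := Sol_cell small ib wb sbZ.
  have [hY sY] := YP _ pL.
  (* The limit was obtained after normalizing at an index [g x] that varies. Since [p_b] is nonzero
     at the limit, renormalizing at the fixed [b] brings the family into the chart for [U]-almost
     all [x]. *)
  pose X' x := normal_at b (normal_at (g x) (X x)).
  have hX' : mtends U X' (cmx (Kn (b, K))).
    have -> : cmx (Kn (b, K)) = normal_at b Z; last exact: mtends_normal_at.
    have [rZ _ _] := sbZ; have [P Pu KE] := eqmx_unit rZ ZK.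
    by rewrite cmxKn /= KE normal_at_mulmx.
  have Udb : U [set x | \det (colsub b (normal_at (g x) (X x))) != 0].
    have hm : tends U (fun x => minors (normal_at (g x) (X x)) b) (minors Z b) by apply: tends_minors.
    by apply: (tends_ne0 hm dbZ).
  have sX' : U [set x | chart_sol c t N a b x (X' x)].
    apply: filterS (UI (UI UX' Ud) Udb) => x /= [[[[rX sX fX] fx] d] db].
    have [iba _] := covers_interlaced ba.
    have X1 : colsub b (X' x) = 1%:M by apply: normal_atE.
    split => //.
    - by apply: (chart_lowtri ib ia iba X1); do 2!apply: schub_mulmx.
    - by move=> l lN; have := fX l lN; rewrite /pform !lform_mulmx => ->; rewrite !mulr0.
    - by move: fx; rewrite /pform !lform_mulmx => ->; rewrite !mulr0.
  have [_ _ _ sK _] := solL b K pL.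
  have Ueq := chart_sol_unique c_neq0 UU UR ia ib ba wb (Kn1R _ pL) (KnSol _ pL) (KnT _ pL) hX' hY sX' sY.
  (* At any one [x] of this set, [X x] spans the plane of a branch, although it was chosen on
     none. *)
  have [x /= [[[xeq xd] xdb] xX]] := @filter_ex _ U UP _ (UI (UI (UI Ueq Ud) Udb) UX).
  apply: xX => _; exists (b, K) => //; rewrite -xeq.
  apply/eqmxP; apply: eqmx_sym; apply: eqmx_trans (normal_at_eqmx xdb) (normal_at_eqmx xd).
have UT : U [set x | forall p, p \in L -> Transv c (upd t N x) N.+1 a (cmx (Y p x))].
  apply: filter_seq => p pL; have [hY sY] := YP p pL.
  have [ba ib wb _ _] : [/\ covers p.1 a, incr p.1, weight p.1 = N, Sol c t N p.1 (cmx p.2)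
    & \det (colsub p.1 (cmx p.2)) != 0] by apply: solL; rewrite -surjective_pairing.
  have := chart_sol_transv c_neq0 UU UR ia ib ba wb (Kn1R p pL) (KnSol p pL) (KnT p pL) hY sY.
  apply: (@filterS _ _ UF) => x h V dV fV; apply: h => //.
    by move=> l lN; have := fV l (ltnW lN); rewrite /upd lN.
  by have := fV N (ltnSn N); rewrite /upd ltnn.
apply: filterS (UI (UI Usol Uinj) (UI Ucomp UT)) => x /= [[xs xi] [xc xT]]; split.
  exists [seq Y p x | p <- L]; split.
  - by rewrite size_map.
  - rewrite map_inj_in_uniq // => p q pL qL E; apply: (xi p pL q qL); rewrite E.
    by rewrite submx_refl.
  - by move=> K /mapP[p pL ->]; apply: xs.
  - by move=> _ _ /mapP[p pL ->] /mapP[q qL ->] E; rewrite (xi p pL q qL E).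
  - by move=> A /xc[p pL E]; exists (Y p x) => //; apply: map_f.
move=> A sA; have [p pL E] := xc A sA; have [rY _ _] := xs p pL.
apply: (Transv_eqmx rY _ (xT p pL)); by rewrite andbC.
Qed.

End OneSequence.

(** The finitely many conditions, one for each [a], hold together on a set of [U], and such a set is
    nonempty. *)
Lemma generic_step : exists x, generic (upd t N x) N.+1.
Proof.
have Upos : U [set x | 0 < x] := U_gt0 UR.
have H a : U [set x | incr a -> weight a = N.+1 -> real_points (upd t N x) N.+1 a /\
    forall A, Sol c (upd t N x) N.+1 a A -> Transv c (upd t N x) N.+1 a A].
  have [ia|] := boolP (incr a); last by move=> _; apply: filterS filterT => x _.
  have [wa|] := eqVneq (weight a) N.+1; last by move=> /eqP ne; apply: filterS filterT => x _ _ /ne.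
  by apply: filterS (near_real_points ia wa) => x h _ _.
have [x /= [[x0 xs] xH]] := @filter_ex _ U UP _ (UI (UI Upos near_no_small) (filter_forall UF H)).
exists x; split => //.
move=> l _; rewrite /upd; case: ifP => // lN.
by case: tN => _ h _; apply: h.
Qed.

End Step.

(** Only the bottom sequence has weight 0; its chart has no free position, so its variety is the
    point spanned by the first [k] basis vectors. *)
Lemma generic0 t : generic t 0.
Proof.
split => // a ia wa.
have a_le (j : 'I_k) : a j = j :> nat.
  by have : is_bot a; [rewrite is_bot_weight // wa|move/forallP/(_ j)/eqP].
have lowE (i : 'I_k) (d : 'I_n) : (a i < d)%N || (d \in codom a).
  case: ltnP => //= da; apply/codomP.
  have dk : (d < k)%N by have := a_le i; have := ltn_ord i; lia.
  by exists (Ordinal dk); apply: val_inj; rewrite /= a_le.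
have chart0 (K : fieldType) (V : 'M[K]_(k, n)) : colsub a V = 0 -> lowtri a V -> V = 0.
  move=> V0 lV; apply/matrixP => i d; have /orP[/lV ->|/codomP[j ->]] := lowE i d; first by rewrite mxE.
  by move/matrixP/(_ i j): V0; rewrite !mxE.
pose K0 : 'M[R]_(k, n) := \matrix_(i, d) (a i == d)%:R.
have K01 : colsub a (cmx K0) = 1%:M.
  by apply/matrixP => i j; rewrite !mxE (inj_eq (incr_inj ia)) rmorph_nat.
have K0l : lowtri a (cmx K0).
  by move=> i d lt; rewrite !mxE; case: eqP lt => [->|_ _]; rewrite ?ltnn // rmorph0.
have cell A : Sol c t 0 a A -> \det (colsub a A) != 0.
  by move=> sA; apply: (Sol_cell (t := t) (N := 0) _ ia wa sA).
have nrm A : Sol c t 0 a A -> normal_at a A = cmx K0.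
  move=> sA; have d := cell A sA; have A1 := normal_atE d.
  apply/eqP; rewrite -subr_eq0; apply/eqP; apply: chart0.
    apply/matrixP => i j; move/matrixP/(_ i j): A1; move/matrixP/(_ i j): K01.
    by rewrite !mxE => -> ->; rewrite subrr.
  have [_ sn _] := normal_at_Sol d sA.
  have l := chart_lowtri ia ia (interlaced_refl ia) A1 sn.
  by move=> i e lt; rewrite mxE [X in _ + X]mxE (l i e lt) (K0l i e lt) subr0.
have K0s : Sol c t 0 a (cmx K0).
  split => //; last exact: lowtri_schub.
  by apply: (@minor_rank _ _ _ _ a); rewrite K01 det1 oner_eq0.
split.
  exists [:: K0]; split => //.
  - by rewrite nchains_bot.
  - by move=> K; rewrite inE => /eqP->.
  - by move=> K K'; rewrite !inE => /eqP-> /eqP->.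
  - move=> A sA; exists K0; first by rewrite inE.
    by rewrite -(nrm A sA) andbC; apply: normal_at_eq; apply: cell.
move=> A sA; have d := cell A sA.
apply: (@Transv_eqmx _ _ _ _ _ _ _ (cmx K0)); first by case: K0s.
  by rewrite -(nrm A sA); apply: normal_at_eq.
move=> V dV _; exists (colsub a V); apply/eqP; rewrite -subr_eq0; apply/eqP.
have V'0 : colsub a (V - colsub a V *m cmx K0) = 0.
  have -> : colsub a (V - colsub a V *m cmx K0) = colsub a V - colsub a V *m colsub a (cmx K0).
    by rewrite -colsub_mulmx; apply/matrixP => i j; rewrite !mxE.
  by rewrite K01 mulmx1 subrr.
apply: chart0 => //; apply: (chart_lowtri_tangent ia ia (interlaced_refl ia) K01 V'0) => e ie ne.
rewrite -scaleN1r addrC minor_quot_linear dV // addr0 minor_quot_vertical.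
by rewrite (lowtri_schub ia K0l) // !mulr0.
Qed.

Lemma Sol_ext t t' N a A : (forall l, (l < N)%N -> t l = t' l) -> Sol c t N a A -> Sol c t' N a A.
Proof. by move=> E [rA sA fA]; split => // l lN; rewrite -E // fA. Qed.

Lemma generic_ext t t' N : (forall l, (l < N)%N -> t l = t' l) -> generic t N -> generic t' N.
Proof.
move=> E [ns tp H]; have E' l : (l < N)%N -> t' l = t l by move=> lN; rewrite E.
split.
- by move=> a A ia wa /(Sol_ext E'); apply: ns.
- by move=> l lN; rewrite -E // tp.
move=> a ia wa; have [[s [h1 h2 h3 h4 h5]] hT] := H a ia wa; split.
  exists s; split => //; first by move=> K /h3; apply: Sol_ext.
  by move=> A /(Sol_ext E'); apply: h5.
move=> A /(Sol_ext E') sA V dV fV; apply: (hT A sA) => // l lN.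
by rewrite E // fV.
Qed.

Lemma generic_sequence M : exists t, forall N, (N <= M)%N -> generic t N.
Proof.
have [U [UU UR]] := ultraFilterLemma (at_right_proper_filter (0 : R)).
elim: M => [|M [t tP]].
  by exists (fun=> 1) => N; rewrite leqn0 => /eqP ->; apply: generic0.
have [x xP] := generic_step UU UR (tP M (leqnn M)).
exists (upd t M x) => N; rewrite leq_eqVlt => /orP[/eqP -> //|].
rewrite ltnS => NM; apply: generic_ext (tP N NM) => l lN.
by rewrite /upd (leq_trans lN NM).
Qed.

End Induction.

(** * Translates of L and conormal spaces *)

Section Translates.
Variables (R : realType) (k m : nat).
Local Notation C := R[i].
Local Notation n := (k + m)%N.
Local Notation seqs := {ffun 'I_k -> 'I_n}.
Variable L : 'M[R]_(m, n).
Hypothesis rankL : \rank L = m.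
Hypothesis hL : forall g : {ffun 'I_m -> 'I_n}, incr g -> \det (colsub g L) != 0.

Lemma complement_seq (b : seqs) : incr b ->
  exists2 g : {ffun 'I_m -> 'I_n}, incr g & forall j, g j \notin codom b.
Proof.
move=> ib; pose D := [set x | x \notin codom b].
have cD : #|D| = m.
  have := cardC (mem (codom b)); rewrite card_codom; last exact: incr_inj.
  rewrite !card_ord => /addnI e; apply: etrans e; apply: eq_card => x; by rewrite !inE.
pose g0 (j : 'I_m) : 'I_n := enum_val (cast_ord (esym cD) j).
have g0i : injective g0 by move=> x y /enum_val_inj/cast_ord_inj.
have [g ig [s sE]] := sort_inj g0i.
by exists g => // j; rewrite sE; have := enum_valP (cast_ord (esym cD) (s j)); rewrite inE.
Qed.

(** On the columns [g] complementary to [b] the unit rows vanish, so a row vector in the kernel has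
    its part [y] killed by the invertible minor [g] of [L]; the columns [b] then kill its part
    [u]. *)
Lemma coplucker_neq0 (b : seqs) : incr b -> coplucker L b != 0.
Proof.
move=> ib; have [g ig gb] := complement_seq ib.
rewrite -unitfE -[_ \is a _]/(_ \in unitmx) -row_free_unit -kermx_eq0.
apply/eqP/row_matrixP => i; rewrite row0.
set v := row i _; have : v *m col_mx (rowsub b 1%:M) L = 0 by apply/sub_kermxP; exact: row_sub.
rewrite -[v]hsubmxK mul_row_col; set u := lsubmx v; set y := rsubmx v => E.
have uE (z : 'I_n) : (u *m rowsub b 1%:M) 0 z = \sum_i u 0 i * (b i == z)%:R.
  by rewrite mxE; apply: eq_bigr => j _; rewrite !mxE.
have y0 : y = 0.
  have gu : colsub g L \in unitmx by rewrite unitmxE unitfE hL.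
  rewrite -[y](mulmxK gu) -colsub_mulmx.
  suff -> : colsub g (y *m L) = 0 by rewrite mul0mx.
  apply/rowP => j; move/rowP/(_ (g j)): E; rewrite [LHS]mxE uE big1 => [|x _].
    by rewrite add0r !mxE.
  case: eqP => [bx|]; last by rewrite mulr0.
  by have := gb j; rewrite -bx codom_f.
have u0 : u = 0.
  apply/rowP => j; move/rowP/(_ (b j)): E; rewrite y0 mul0mx addr0 uE.
  rewrite (bigD1 j) //= eqxx mulr1 big1 => [|x /negbTE xj]; last first.
    by rewrite (inj_eq (incr_inj ib)) xj mulr0.
  by rewrite addr0 => ->; rewrite !mxE.
by rewrite u0 y0 row_mx0.
Qed.

Definition torus (t : R) : 'M[R]_n := diag_mx (\row_(j < n) t ^+ j.+1).

Lemma tactE t : tact t L = L *m torus t.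
Proof. by apply/matrixP => i j; rewrite mul_mx_diag !mxE. Qed.

Lemma det_torus t : \det (torus t) = t ^+ (\sum_(j < n) j.+1)%N.
Proof. by rewrite det_diag expr_sum; apply: eq_bigr => j _; rewrite mxE. Qed.

Lemma torus_unit t : t != 0 -> torus t \in unitmx.
Proof. by move=> t0; rewrite unitmxE unitfE det_torus expf_neq0. Qed.

(** The part of the effect of [t] on the coefficients that does not depend on [b]; being nonzero, it
    disappears from the equation. *)
Definition scale_factor (t : R) : R := t ^+ (\sum_(j < n) j.+1)%N / t ^+ (\sum_(i < k) i.+1)%N.

Lemma coplucker_tact (b : seqs) t : incr b -> t != 0 ->
  coplucker (tact t L) b = scale_factor t * wt (coplucker L) t b.
Proof.
move=> ib t0; pose Db : 'M[R]_k := diag_mx (\row_(i < k) t ^+ (b i).+1).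
have Db_det : \det Db = t ^+ weight b * t ^+ (\sum_(i < k) i.+1)%N.
  rewrite det_diag -exprD; have -> : (weight b + \sum_(i < k) i.+1 = \sum_(i < k) (b i).+1)%N.
    rewrite /weight -big_split; apply: eq_bigr => i _ /=.
    by rewrite addnS subnK // incr_ge.
  by rewrite expr_sum; apply: eq_bigr => j _; rewrite mxE.
(* Multiplying the unit rows [b] by the torus on the right amounts to multiplying them by [Db] on
   the left, so the torus can be factored out of the whole determinant. *)
have E : \det Db * coplucker (tact t L) b = coplucker L b * \det (torus t).
  have dU : \det (block_mx Db 0 0 (1%:M : 'M_m)) = \det Db by rewrite det_ublock det1 mulr1.
  rewrite /coplucker -dU -!det_mulmx.
  congr (\det _); rewrite mul_block_col mul_col_mx !mul0mx mul1mx addr0 add0r tactE.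
  congr col_mx; apply/matrixP => i j; rewrite mul_diag_mx mul_mx_diag !mxE.
  by case: eqP => [<-|_] /=; rewrite ?mulr1n ?mulr0n ?mulr1 ?mul1r ?mulr0 ?mul0r.
have dn0 : \det Db != 0 by rewrite Db_det mulf_neq0 ?expf_neq0.
apply: (mulfI dn0); rewrite E Db_det det_torus /scale_factor /wt.
by field; rewrite !expf_neq0.
Qed.

Lemma det_col_mx_tact (A : 'M[C]_(k, n)) t : t != 0 ->
  \det (col_mx A (cmx (tact t L))) = cR (scale_factor t) * pform (coplucker L) t A.
Proof.
move=> t0; rewrite laplace_col_mx /pform /lform mulr_sumr; apply: eq_bigr => b ib.
rewrite /minors mulrA; congr (_ * _).
have -> : coplucker (cmx (tact t L)) b = cR (coplucker (tact t L) b).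
  rewrite /coplucker -det_map_mx; congr (\det _); rewrite map_col_mx; congr col_mx.
  by apply/matrixP => i j; rewrite !mxE rmorph_nat.
by rewrite coplucker_tact // rmorphM.
Qed.

Lemma scale_factor_neq0 t : t != 0 -> scale_factor t != 0.
Proof. by move=> t0; rewrite mulf_neq0 ?invr_eq0 ?expf_neq0. Qed.

(** The ranks of [A] and [B] add up to the ambient dimension, so the intersection is zero exactly
    when the stacked square matrix is invertible. *)
Lemma inOmegaM_pform (A : 'M[C]_(k, n)) t : t != 0 -> \rank A = k ->
  inOmegaM (cmx (tact t L)) A <-> pform (coplucker L) t A = 0.
Proof.
move=> t0 rA; set B := cmx (tact t L).
have rB : \rank B = m.
  by rewrite /B /cmx mxrank_map tactE mxrankMfree // row_free_unit torus_unit.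
have := mxrank_sum_cap A B; rewrite rA rB => cap.
have rAB : \rank (A + B)%MS = \rank (col_mx A B) by rewrite (addsmxE A B).
have sf : cR (scale_factor t) != 0 by rewrite fmorph_eq0 scale_factor_neq0.
rewrite /inOmegaM; split => [nz|fA].
  apply/eqP; apply: contraNT nz => fA.
  have : col_mx A B \in unitmx by rewrite unitmxE unitfE det_col_mx_tact // mulf_neq0.
  by move/mxrank_unit; rewrite -rAB => r; move: cap; rewrite r; lia.
apply/eqP => z; have : col_mx A B \in unitmx.
  by rewrite -row_free_unit /row_free -rAB; apply/eqP; move: cap; rewrite z addn0.
by rewrite unitmxE unitfE det_col_mx_tact // fA mulr0 eqxx.
Qed.

Lemma dpluckerE (b : seqs) (A V : 'M[C]_(k, n)) : dplucker b A V = minor_quot b A A V.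
Proof. by rewrite minor_quot_coef1. Qed.

Lemma ddetE (A V : 'M[C]_(k, n)) t : t != 0 ->
  ddet (cmx (tact t L)) A V = cR (scale_factor t) * dpform (coplucker L) t A V.
Proof.
move=> t0; rewrite /ddet laplace_col_mx coef_sum /dpform /lform mulr_sumr.
apply: eq_bigr => b ib; rewrite mulrA.
have -> : coplucker (pmx (cmx (tact t L))) b = (cR (coplucker (tact t L) b))%:P.
  rewrite /coplucker -!det_map_mx; congr (\det _); rewrite !map_col_mx; congr col_mx.
  by apply/matrixP => i j; rewrite !mxE !rmorph_nat.
by rewrite coefCM coplucker_tact // rmorphM /quots minor_quot_coef1.
Qed.

End Translates.

(** * Ranks of the conormal spaces *)

Section Conormal.
Variables (R : realType) (k m : nat).
Local Notation C := R[i].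
Local Notation n := (k + m)%N.
Local Notation seqs := {ffun 'I_k -> 'I_n}.

Lemma grad_apply (f : 'M[C]_(k, n) -> C) (V : 'M[C]_(k, n)) :
  (forall x V W, f (x *: V + W) = x * f V + f W) -> grad f *m (mxvec V)^T = (f V)%:M.
Proof.
move=> fl; apply/rowP => j; rewrite ord1 !mxE eqxx mulr1n.
have f0 : f 0 = 0 by have := fl (-1) 0 0; rewrite scaler0 addr0 mulN1r addNr.
have fs (I : Type) (r : seq I) (x : I -> C) (E : I -> 'M[C]_(k, n)) :
    f (\sum_(i <- r) x i *: E i) = \sum_(i <- r) x i * f (E i).
  elim: r => [|i r IH]; first by rewrite !big_nil.
  by rewrite !big_cons fl IH.
have VE : V = \sum_(i < k * n) mxvec V 0 i *: vec_mx (delta_mx 0 i).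
  rewrite -[LHS]mxvecK [mxvec V in LHS]row_sum_delta linear_sum.
  by apply: eq_bigr => i _; rewrite linearZ.
rewrite [in RHS]VE fs; apply: eq_bigr => i _.
by rewrite mxE [(mxvec V)^T _ _]mxE mulrC.
Qed.

Lemma grad_apply0 (f : 'M[C]_(k, n) -> C) (u : 'rV[C]_(k * n)) :
  (forall x V W, f (x *: V + W) = x * f V + f W) ->
  grad f *m u^T = 0 <-> f (vec_mx u) = 0.
Proof.
move=> fl; rewrite -[in X in X <-> _](vec_mxK u) (grad_apply _ fl).
split=> [/matrixP/(_ 0 0)|->]; first by rewrite !mxE eqxx mulr1n.
by apply/matrixP => i j; rewrite !mxE mul0rn.
Qed.

Lemma sum_genmx_annihilates (I : finType) (P : pred I) (A : I -> 'rV[C]_(k * n)) (u : 'rV[C]_(k * n)) :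
  (\sum_(i | P i) <<A i>>)%MS *m u^T = 0 -> forall i, P i -> A i *m u^T = 0.
Proof.
move=> /sub_kermxP/sumsmx_subP H i Pi; apply/sub_kermxP.
by have := H i Pi; rewrite genmxE.
Qed.

Lemma rank_sum_le (I : finType) (P : pred I) (A : I -> 'M[C]_(k * n)) :
  (\rank (\sum_(i | P i) A i)%MS <= \sum_(i | P i) \rank (A i))%N.
Proof.
elim/big_rec2: _ => [|i y B _ IH]; first by rewrite mxrank0.
by apply: leq_trans (mxrank_adds_leqif _ _) _; rewrite leq_add2l.
Qed.

Lemma dplucker_linear (e : seqs) (A : 'M[C]_(k, n)) x V W :
  dplucker e A (x *: V + W) = x * dplucker e A V + dplucker e A W.
Proof. by rewrite !dpluckerE minor_quot_linear. Qed.

(* The annihilator contains the vertical directions [M *m A] and those of the cell of [a]. *)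
Lemma schubert_conormal_rank (a : seqs) (A : 'M[C]_(k, n)) : incr a -> schub a A ->
  \det (colsub a A) != 0 -> (\rank (schubert_conormal a A) + weight a <= k * m)%N.
Proof.
move=> ia sA dA.
pose P := colsub a A; have Pu : P \in unitmx by rewrite unitmxE unitfE.
pose A' := normal_at a A; have AE : A = P *m A' by rewrite mulKVmx.
have A1 : colsub a A' = 1%:M by apply: normal_atE.
have iaa := interlaced_refl ia.
have lA' : lowtri a A' by apply: (chart_lowtri ia ia iaa A1); apply: schub_mulmx.
pose w := #|chart_pos a a|.
have wE : w = weight a by apply: card_chart_pos.
(* [Z1] spans the vertical directions, [Z2] the cell directions carried from the normal form [A'] to
   [A = P *m A']. *)
pose Z1 : 'M[C]_(k * k, k * n) := lin_mulmxr A.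
pose Z2 : 'M[C]_(w, k * n) := \matrix_i mxvec (P *m pos_mx C i).
pose Z := col_mx Z1 Z2.
have ZE (v : 'rV[C]_(k * k + w)) :
    v *m Z = mxvec (vec_mx (lsubmx v) *m A + P *m emb (rsubmx v)).
  rewrite -{1}[v]hsubmxK mul_row_col linearD /=; congr (_ + _).
    by rewrite -{1}(vec_mxK (lsubmx v)) mul_vec_lin.
  rewrite mulmx_sum_row /emb mulmx_sumr linear_sum; apply: eq_bigr => i _ /=.
  by rewrite rowK -scalemxAr linearZ.
have Zfree : \rank Z = (k * k + w)%N.
  apply/eqP; rewrite -[_ == _]/(row_free Z) -kermx_eq0.
  apply/eqP/row_matrixP => i; rewrite row0.
  set v := row i _; have : v *m Z = 0 by apply/sub_kermxP; exact: row_sub.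
  rewrite ZE => /(congr1 vec_mx); rewrite mxvecK linear0.
  set M := vec_mx _; set y := rsubmx v => E.
  have [e0 _] := emb_chart y.
  (* The cell directions have zero columns [a], so these columns see only the vertical part. *)
  have MP : M *m P = 0.
    have : colsub a (M *m A + P *m emb y) = 0 by rewrite E; apply/matrixP => r d; rewrite !mxE.
    have -> : colsub a (M *m A + P *m emb y) = colsub a (M *m A) + colsub a (P *m emb y).
      by apply/matrixP => r d; rewrite mxE [LHS]mxE [RHS]mxE [X in _ = X + _]mxE [X in _ = _ + X]mxE.
    by rewrite !colsub_mulmx e0 mulmx0 addr0.
  have M0 : M = 0 by rewrite -(mulmxK Pu M) MP mul0mx.
  have y0 : y = 0.
    apply: emb_inj0; move: E; rewrite M0 mul0mx add0r => /(congr1 (mulmx (invmx P))).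
    by rewrite mulKmx // mulmx0.
  by rewrite -[v]hsubmxK -/y y0 -(vec_mxK (lsubmx v)) -/M M0 linear0 row_mx0.
have sub : (schubert_conormal a A <= kermx Z^T)%MS.
  apply/sumsmx_subP => e /andP[ie ne]; rewrite genmxE; apply/sub_kermxP.
  apply: trmx_inj; rewrite trmx_mul trmxK trmx0; apply/row_matrixP => j; rewrite row0.
  rewrite row_mul; apply: trmx_inj; rewrite trmx_mul trmxK trmx0.
  apply/grad_apply0; first exact: dplucker_linear.
  rewrite rowE ZE mxvecK dpluckerE addrC -[P *m _]scale1r minor_quot_linear mul1r.
  rewrite minor_quot_vertical sA // mulr0 addr0 AE minor_quot_mulmx.
  by rewrite (minor_quot_lowtri ia ie) ?mulr0 //; have [] := emb_chart (rsubmx (delta_mx 0 j : 'rV[C]_(k * k + w))).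
have := mxrankS sub; rewrite mxrank_ker mxrank_tr Zfree wE => h.
have := rank_leq_col Z; rewrite Zfree wE; move: h; move: (\rank (schubert_conormal a A)) => r.
by rewrite mulnDr; lia.
Qed.

(* The annihilator of all differentials has dimension at most [k * k], so the three upper bounds on the ranks are sharp. *)
Lemma transverse_ranks (a : seqs) (A : 'M[C]_(k, n)) (M : nat) (B : 'I_M -> 'M[C]_(m, n)) :
  incr a -> schub a A -> \det (colsub a A) != 0 -> (weight a <= M)%N ->
  (forall i x V W, ddet (B i) A (x *: V + W) = x * ddet (B i) A V + ddet (B i) A W) ->
  (forall V, (forall e, incr e -> ~~ bruhat_le e a -> minor_quot e A A V = 0) ->
     (forall i : 'I_M, (i < weight a)%N -> ddet (B i) A V = 0) -> exists N, V = N *m A) ->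
  transverse_at (weight a) a B A.
Proof.
move=> ia sA dA wM dl T.
have W1 := schubert_conormal_rank ia sA dA.
set W := (schubert_conormal a A + \sum_(i < M | (i < weight a)%N) omegaM_conormal (B i) A)%MS.
have cW : (k * m <= \rank W)%N.
  (* A vector annihilated by all the differentials is vertical by [T], and the vertical directions
     are the image of a space of dimension [k * k]. *)
  have sub : (kermx W^T <= (lin_mulmxr A : 'M[C]_(k * k, k * n)))%MS.
    apply/row_subP => i; set u := row i _.
    have : u *m W^T = 0 by apply/sub_kermxP; exact: row_sub.
    move/(congr1 trmx); rewrite trmx_mul trmxK trmx0 => /sub_kermxP.
    rewrite addsmx_sub => /andP[/sub_kermxP H1 /sub_kermxP H2].
    have [e ie ne|j ja|N VN] := T (vec_mx u).
    - rewrite -dpluckerE; apply/(grad_apply0 _ (dplucker_linear e A)).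
      by apply: (sum_genmx_annihilates H1); rewrite ie ne.
    - apply/(grad_apply0 _ (dl j)).
      exact: (sum_genmx_annihilates H2).
    apply/submxP; exists (mxvec N); rewrite mul_vec_lin /= -VN.
    by rewrite vec_mxK.
  have := leq_trans (mxrankS sub) (rank_leq_row _); rewrite mxrank_ker mxrank_tr.
  by move: (\rank W) => r; rewrite mulnDr; lia.
have om1 i : (\rank (omegaM_conormal (B i) A) <= 1)%N.
  by rewrite /omegaM_conormal mxrank_gen rank_leq_row.
have cardw : (\sum_(i < M | (i < weight a)%N) 1 = weight a)%N.
  by rewrite -(big_ord_widen _ (fun=> 1%N) wM) sum1_card card_ord.
have sumw : (\sum_(i < M | (i < weight a)%N) \rank (omegaM_conormal (B i) A) <= weight a)%N.
  by rewrite -[X in (_ <= X)%N]cardw; apply: leq_sum.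
have rW : (\rank W <= \rank (schubert_conormal a A) +
    \sum_(i < M | (i < weight a)%N) \rank (omegaM_conormal (B i) A))%N.
  by apply: leq_trans (mxrank_adds_leqif _ _) _; rewrite leq_add2l rank_sum_le.
split; [lia| |rewrite -/W; lia].
(* One vanishing rank would make the hyperplane contributions sum to less than [weight a], too
   little to reach [k * m]. *)
move=> i iw; apply/eqP; rewrite eqn_leq om1 lt0n; apply/negP => /eqP z.
have : (\sum_(i < M | (i < weight a)%N) \rank (omegaM_conormal (B i) A) < weight a)%N.
  rewrite -[X in (_ < X)%N]cardw (bigD1 i) //= z [X in (_ < X)%N](bigD1 i) //= add0n add1n ltnS.
  by apply: leq_sum.
lia.
Qed.

End Conormal.

(** The [k - 1 - j] strict increases after index [j] leave [a j <= j + m], so [k * m] parameters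
    suffice for every [a]. *)
Lemma weight_bound (k m : nat) (a : {ffun 'I_k -> 'I_(k + m)}) : incr a -> (weight a <= k * m)%N.
Proof.
move=> ia; rewrite -[X in (_ <= X * _)%N](card_ord k) -sum_nat_const; apply: leq_sum => j _.
suff H (d : nat) (jd : (j + d < k)%N) : (a j + d <= a (Ordinal jd))%N.
  have jk : (j + (k.-1 - j) < k)%N by have := ltn_ord j; lia.
  have := H _ jk; have := ltn_ord (a (Ordinal jk)); have := ltn_ord j; lia.
elim: d jd => [|d IH] jd.
  rewrite addn0 (_ : Ordinal jd = j) //; apply: val_inj; exact: addn0.
have jd' : (j + d < k)%N by lia.
have := IH jd'; have : (a (Ordinal jd') < a (Ordinal jd))%N by apply: (incrP _ ia) => /=; lia.
lia.
Qed.

Theorem mainTheorem5 (R : realType) (k m : nat) (hk : (0 < k)%N) (hm : (0 < m)%N)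
    (Lm : 'M[R]_(m, k + m))
    (hLrank : \rank Lm = m)
    (hL : forall g : {ffun 'I_m -> 'I_(k + m)}, incr g -> \det (colsub g Lm) != 0) :
  exists t : 'I_(k * m) -> R,
    (forall i, t i != 0) /\
    forall a : {ffun 'I_k -> 'I_(k + m)}, incr a ->
      let B := fun i : 'I_(k * m) => cmx (tact (t i) Lm) in
      let inX := fun A : 'M[R[i]]_(k, k + m) =>
        [/\ \rank A = k, inSchubert a A &
            forall i : 'I_(k * m), (i < weight a)%N -> inOmegaM (B i) A] in
      (* exactly d(alpha) points *)
      (exists P : 'I_(nchains a) -> 'M[R[i]]_(k, k + m),
         (forall j, inX (P j)) /\
         (forall j j', (P j == P j')%MS -> j = j') /\
         (forall A, inX A -> exists j, (A == P j)%MS)) /\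
      (* all points are real *)
      (forall A, inX A -> exists Br : 'M[R]_(k, k + m), (A == cmx Br)%MS) /\
      (* the intersection is transverse at every point *)
      (forall A, inX A ->
         @transverse_at R k m (k * m) (weight a) a B A).
Proof.
(* The hypothesis on the Pluecker coordinates of [Lm] enters here, as the nonvanishing of all
   coefficients of the degenerating forms. *)
have cn0 := coplucker_neq0 hL.
have [t tP] := generic_sequence cn0 (k * m).
have t0 (i : 'I_(k * m)) : t i != 0.
  by have [_ /(_ i (ltn_ord i)) h _] := tP (k * m)%N (leqnn _); rewrite gt_eqF.
exists (fun i => t i); split => // a ia B inX.
have wa := weight_bound ia.
have inXE A : inX A <-> Sol (coplucker Lm) t (weight a) a A.
  split=> -[rA sA fA]; split => //.
    move=> l lw; have lM := leq_trans lw wa.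
    by have /(inOmegaM_pform hLrank (t0 (Ordinal lM)) rA) := fA (Ordinal lM) lw.
  by move=> i iw; apply/(inOmegaM_pform hLrank (t0 i) rA)/fA.
have [small _ /(_ a ia erefl)[[s [ss us sS si sc]] sT]] := tP _ wa.
split; [|split].
- exists (fun j => cmx (nth 0 s j)); split; [|split].
  + by move=> j; apply/inXE/sS/mem_nth; rewrite ss.
  + move=> j j' E; have ltj (i : 'I_(nchains a)) : (i < size s)%N by rewrite ss.
    apply/val_inj/(uniqP 0 us); [exact: ltj|exact: ltj|].
    by apply: si => //; apply: mem_nth; apply: ltj.
  + move=> A /inXE/sc[K Ks E]; have iK : (index K s < nchains a)%N by rewrite -ss index_mem.
    by exists (Ordinal iK); rewrite /= nth_index.
- by move=> A /inXE/sc[K _ E]; exists K.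
move=> A /inXE sA; have [_ sch _] := sA.
apply: (transverse_ranks ia sch (Sol_cell small ia erefl sA) wa).
  by move=> i x V W; rewrite !ddetE // /dpform lform_quots_linear mulrDr mulrCA.
move=> V dV fV; apply: (sT A sA) => // l lw; have lM := leq_trans lw wa.
have := fV (Ordinal lM) lw; rewrite ddetE // => /eqP.
by rewrite mulf_eq0 fmorph_eq0 (negbTE (scale_factor_neq0 _ _ (t0 _))) /= => /eqP.
Qed.
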